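(* Let $\theta>0$ and assume $\det\gamma_k\ne0$ for all $k\ge1$. Assume that the block operators $\mathsf A,\mathsf B,\mathsf C,\mathcal H_\theta$ below define bounded operators between the corresponding $\ell^2$-direct sums, that $sI-\mathsf A$ is boundedly invertible for all $\mathrm{Re}\,s\ge0$, and that there is a bounded self-adjoint operator $\mathsf Q_\theta$ on $\mathcal X:=\bigoplus_{k\ge0}\mathbb C^N$ solving the Riccati equation $$\mathsf A^T\mathsf Q_\theta+\mathsf Q_\theta\mathsf A+\theta\,\mathsf C^T\mathcal H_\theta\mathsf C+\mathsf L_\theta^*\mathsf L_\theta=0,\qquad \mathsf L_\theta:=\mathsf B^*\mathsf Q_\theta,$$ which is stabilizing in the sense that the spectrum of $\mathsf A+\mathsf B\mathsf L_\theta$ lies in the open left half-plane. Then the transfer function $\mathcal G_\theta(s):=I_m+\mathsf L_\theta(sI-\mathsf A-\mathsf B\mathsf L_\theta)^{-1}\mathsf B$ satisfies $\mathcal G_\theta(i\lambda)$ invertible and $$\Delta_\theta(\lambda)^{-1}=\mathcal G_\theta(i\lambda)\mathcal G_\theta(i\lambda)^*\qquad\text{for all }\lambda\in\mathbb R .$$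
   Context: Let $m,N$ be even, $\mathbf J=\begin{bmatrix}0&1\\-1&0\end{bmatrix}$, $J:=I_{m/2}\otimes\mathbf J$, $\Omega:=I_m+iJ$, $S:=\Omega^T/\sqrt2$. Let $\Theta\in\mathbb R^{N\times N}$ be antisymmetric and nonsingular, $\mathcal A\in\mathbb R^{N\times N}$ Hurwitz, $\mathcal B\in\mathbb R^{N\times m}$, $\mathcal C\in\mathbb R^{r\times N}$ with $\mathcal A\Theta+\Theta\mathcal A^T+\mho=0$, where $\mho:=\mathcal BJ\mathcal B^T$; $\Pi:=\mathcal C^T\mathcal C$; $G(s):=(sI_N-\mathcal A)^{-1}$, $F(s):=\mathcal CG(s)\mathcal B$, $\Psi(\lambda):=F(i\lambda)JF(i\lambda)^*$; $(\cdot)^*$ is adjoint/conjugate transpose. $\phi(u):=(e^u-1)/u=\sum_{k\ge0}\phi_ku^k$, $\phi_k=1/(k+1)!$, applied to matrices via the series; $\Sigma_\theta(\lambda):=SF(i\lambda)^*\phi(2i\theta\Psi(\lambda))F(i\lambda)S$, $\Delta_\theta:=I_m-\theta\Sigma_\theta$. For a matrix $U$, $\mathbf L_{\mathcal A}(U):=\int_0^\infty e^{t\mathcal A}Ue^{t\mathcal A^T}dt$. Recursion: $\alpha_1=\gamma_0=\Theta$, $\beta_0=I_N$, $\beta_1=\Theta^{-1}\mho\Theta^{-1}$, and for $k\ge1$: $\gamma_k=\mathbf L_{\mathcal A}(\alpha_k\Pi^{\delta_{k1}}\gamma_{k-1})$, $\alpha_{k+1}=\gamma_k\beta_k$, $\beta_{k+1}=\gamma_k^{-1}\alpha_k\Pi^{\delta_{k1}}\gamma_{k-1}\gamma_k^{-1}$,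 where $\Pi^{\delta_{k1}}$ equals $\Pi$ if $k=1$ and $I_N$ otherwise. $\mathcal H_\theta:=\mathrm{diag}\big(I_r,\mathrm{diag}_{k\ge1}((-2i\theta)^k\phi_k\beta_k)\big)$ acting on $\mathbb C^r\oplus\bigoplus_{k\ge1}\mathbb C^N$. Infinite state-space matrices: $\mathsf A$ is block lower bidiagonal on $\mathcal X=\bigoplus_{k\ge0}\mathbb C^N$ with diagonal blocks $\mathcal A$ and subdiagonal blocks $\alpha_1\Pi,\alpha_2,\alpha_3,\dots$ (i.e. $(\mathsf Ax)_0=\mathcal Ax_0$, $(\mathsf Ax)_1=\alpha_1\Pi x_0+\mathcal Ax_1$, $(\mathsf Ax)_k=\alpha_kx_{k-1}+\mathcal Ax_k$ for $k\ge2$); $\mathsf B:\mathbb C^m\to\mathcal X$, $\mathsf Bv=(\mathcal BSv,0,0,\dots)$; $\mathsf C:\mathcal X\to\mathbb C^r\oplus\bigoplus_{k\ge1}\mathbb C^N$, $\mathsf Cx=(\mathcal Cx_0,x_1,x_2,\dots)$. (Then $\mathsf C(sI-\mathsf A)^{-1}\mathsf B=\mathcal F(s)F(s)S$ with $\mathcal F=(I_r,G_1,G_2,\dots)$, $G_k(s)=G(s)\alpha_k\cdots G(s)\alpha_1\mathcal C^T$.) *)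

(* Defs.v *)
From HB Require Import structures.
From mathcomp Require Import all_boot all_order all_algebra.
From mathcomp Require Import all_classical all_reals all_analysis.
From mathcomp Require Import complex.
Set Implicit Arguments. Unset Strict Implicit. Unset Printing Implicit Defensive.
Import Order.TTheory GRing.Theory Num.Theory.
Import numFieldNormedType.Exports.
Local Open Scope ring_scope.

Section Defs.
Variable R : realType.
Local Notation C := R[i].

Definition slim (u : nat -> R) : R := limn u.

Definition cmx m n (M : 'M[R]_(m, n)) : 'M[C]_(m, n) := map_mx (fun x => (x%:C)%C) M.
Definition adj m n (M : 'M[C]_(m, n)) : 'M[C]_(n, m) := (map_mx (@conjc R) M)^T.
Definition ilam (lam : R) : C := Complex 0 lam.

(* J = I_{m/2} (x) [[0,1],[-1,0]]  (entrywise; meaningful for m even) *)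
Definition Jmx m : 'M[R]_m := \matrix_(i < m, j < m)
  (if ~~ odd i && (j == i.+1 :> nat) then 1
   else if odd i && (j.+1 == i :> nat) then -1 else 0).
Definition Omega m : 'M[C]_m := 1%:M + (Complex 0 1) *: cmx (Jmx m).
Definition Smx m : 'M[C]_m := ((Num.sqrt (2 : R))^-1)%:C%C *: (Omega m)^T.

Definition hurwitz N (A : 'M[R]_N) : Prop :=
  forall s : C, 0 <= @complex.Re R s -> \det (s%:M - cmx A) != 0.

Definition expmR N (M : 'M[R]_N) : 'M[R]_N := \matrix_(i, j)
  slim (fun n : nat => (\sum_(k < n) (k`!%:R)^-1 *: M ^+ k) i j).

Definition LA N (A U : 'M[R]_N) : 'M[R]_N := \matrix_(i, j)
  Rintegral (@lebesgue_measure R) [set t : R | 0 <= t]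
    (fun t => (expmR (t *: A) *m U *m expmR (t *: A^T)) i j).

Variables (N m r : nat) (A Theta : 'M[R]_N) (Bc : 'M[R]_(N, m)) (Cc : 'M[R]_(r, N)).

Definition Mho : 'M[R]_N := Bc *m Jmx m *m Bc^T.
Definition Pimx : 'M[R]_N := Cc^T *m Cc.

(* abg k = (alpha_{k+1}, beta_{k+1}, gamma_k) *)
Fixpoint abg (k : nat) : 'M[R]_N * 'M[R]_N * 'M[R]_N :=
  match k with
  | 0 => (Theta, invmx Theta *m Mho *m invmx Theta, Theta)
  | k'.+1 =>
      let '(a, b, g) := abg k' in
      let P := if k' == 0%N then Pimx else 1%:M in
      let g' := LA A (a *m P *m g) in
      (g' *m b, invmx g' *m a *m P *m g *m invmx g', g')
  end.
Definition alpha (k : nat) : 'M[R]_N := (abg k.-1).1.1.          (* k >= 1 *)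
Definition beta (k : nat) : 'M[R]_N :=
  if k is k'.+1 then (abg k').1.2 else 1%:M.
Definition gamma (k : nat) : 'M[R]_N := (abg k).2.

Definition Gs (s : C) : 'M[C]_N := invmx (s%:M - cmx A).
Definition Fs (s : C) : 'M[C]_(r, m) := cmx Cc *m Gs s *m cmx Bc.
Definition Psi (lam : R) : 'M[C]_r := Fs (ilam lam) *m cmx (Jmx m) *m adj (Fs (ilam lam)).
Definition phimx n (M : 'M[C]_n) : 'M[C]_n := \matrix_(i, j)
  Complex (slim (fun p : nat => @complex.Re R ((\sum_(k < p) ((k.+1)`!%:R)^-1 *: M ^+ k) i j)))
          (slim (fun p : nat => @complex.Im R ((\sum_(k < p) ((k.+1)`!%:R)^-1 *: M ^+ k) i j))).
Definition Sigma (theta lam : R) : 'M[C]_m :=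
  Smx m *m adj (Fs (ilam lam)) *m
  phimx ((((2 * theta)%:C)%C * Complex 0 1) *: Psi lam) *m Fs (ilam lam) *m Smx m.
Definition Delta (theta lam : R) : 'M[C]_m := 1%:M - (theta%:C)%C *: Sigma theta lam.

(* ---- the l^2 spaces X = (+)_{k>=0} C^N and Y = C^r (+) (+)_{k>=1} C^N ---- *)
Definition Xs := nat -> 'cV[C]_N.
(* Y is represented as a pair; (y.2 k) is the component of index k+1 *)
Definition Ys := ('cV[C]_r * (nat -> 'cV[C]_N))%type.

Definition sqn n (v : 'cV[C]_n) : R := \sum_i ((@complex.Re R (v i 0)) ^+ 2 + (@complex.Im R (v i 0)) ^+ 2).
Definition l2bnd n (x : nat -> 'cV[C]_n) (M : R) : Prop :=
  forall p, \sum_(k < p) sqn (x k) <= M.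
Definition l2 n (x : nat -> 'cV[C]_n) : Prop := exists M, l2bnd x M.
Definition l2bndY (y : Ys) (M : R) : Prop :=
  forall p, sqn y.1 + \sum_(k < p) sqn (y.2 k) <= M.

(* bounded operators (||T x||^2 <= c ||x||^2) *)
Definition bddXX (T : Xs -> Xs) : Prop :=
  exists c : R, forall x M, l2bnd x M -> l2bnd (T x) (c * M).
Definition bddXY (T : Xs -> Ys) : Prop :=
  exists c : R, forall x M, l2bnd x M -> l2bndY (T x) (c * M).
Definition bddYY (T : Ys -> Ys) : Prop :=
  exists c : R, forall y M, l2bndY y M -> l2bndY (T y) (c * M).
Definition bddmX (T : 'cV[C]_m -> Xs) : Prop :=
  exists c : R, forall v, l2bnd (T v) (c * sqn v).
Definition linXX (T : Xs -> Xs) : Prop :=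
  forall (a : C) (x y : Xs), l2 x -> l2 y ->
    T (fun k => a *: x k + y k) = (fun k => a *: T x k + T y k).

Definition ip (x y : Xs) : C :=
  Complex (slim (fun p : nat => @complex.Re R (\sum_(k < p) (adj (x k) *m y k) 0 0)))
          (slim (fun p : nat => @complex.Im R (\sum_(k < p) (adj (x k) *m y k) 0 0))).

Definition is_binv (M T : Xs -> Xs) : Prop :=
  [/\ linXX T, bddXX T, (forall x, l2 x -> T (M x) = x)
    & (forall x, l2 x -> M (T x) = x)].
Definition binv (M : Xs -> Xs) : Prop := exists T, is_binv M T.

Definition subd (k : nat) : 'M[R]_N := if k == 1%N then alpha 1 *m Pimx else alpha k.
Definition Aop (x : Xs) : Xs := fun k =>
  cmx A *m x k + (if k is k'.+1 then cmx (subd k) *m x k' else 0).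
Definition ATop (x : Xs) : Xs := fun k =>
  cmx A^T *m x k + cmx (subd k.+1)^T *m x k.+1.
Definition Bop (v : 'cV[C]_m) : Xs := fun k =>
  if k == 0%N then cmx Bc *m Smx m *m v else 0.
Definition Bstar (x : Xs) : 'cV[C]_m := adj (cmx Bc *m Smx m) *m x 0%N.
Definition Cop (x : Xs) : Ys := (cmx Cc *m x 0%N, fun k => x k.+1).
Definition CTop (y : Ys) : Xs := fun k =>
  if k is k'.+1 then y.2 k' else cmx Cc^T *m y.1.
Definition Hblk (theta : R) (k : nat) : 'M[C]_N :=
  ((- ((2 * theta)%:C)%C * Complex 0 1) ^+ k * ((k.+1)`!%:R)^-1) *: cmx (beta k).
Definition Hop (theta : R) (y : Ys) : Ys := (y.1, fun k => Hblk theta k.+1 *m y.2 k).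

(* transfer function G_theta(s) = I + L (sI - A - BL)^{-1} B, given the inverse Rinv *)
Definition Gtf (L : Xs -> 'cV[C]_m) (Rinv : Xs -> Xs) : 'M[C]_m :=
  1%:M + \matrix_(i < m, j < m) (L (Rinv (Bop (delta_mx j 0)))) i 0.

End Defs.

(* Main.v *)
Require Import Defs.
From HB Require Import structures.
From mathcomp Require Import all_boot all_order all_algebra.
From mathcomp Require Import all_classical all_reals all_analysis.
From mathcomp Require Import complex.
From mathcomp Require Import measurable_realfun.
From mathcomp Require Import ring lra.
Import Order.TTheory GRing.Theory Num.Theory.
Import numFieldNormedType.Exports.
Local Open Scope classical_set_scope.
Local Open Scope ring_scope.
Set Implicit Arguments. Unset Strict Implicit. Unset Printing Implicit Defensive.

(* Fix s = i lam.  Let y_j be the closed-loop state (sI - A - BL)^-1 B e_j and w_j = G e_j, so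
   that (sI - A) y_j = B w_j and L y_j = w_j - e_j.  Pairing the Riccati equation with y_i and
   y_j, the terms in s cancel because s is imaginary, and completing the square leaves
     <w_i, w_j> - theta <C y_i, H C y_j> = <e_i, e_j>.
   The state y_j is the cascade y_0 = G(s) B S w, y_k = G_k(s) F(s) S w, and
   G_k^* beta_k G_k = (-1)^k Psi^k, so <C y_i, H C y_j> is the exponential-type series
   <w_i, Sigma w_j>.  Hence G^* Delta G = I, which gives all three claims.
   The identity for G_k rests on two facts: the parities gamma_k^T = (-1)^(k+1) gamma_k and
   beta_k^T = (-1)^k beta_k, and the Lyapunov equations A gamma_k + gamma_k A^T + (...) = 0.
   The latter follow from the integral defining L_A once exp(tA) is known to decay, which is
   obtained from Cayley-Hamilton by peeling off one linear factor of the characteristic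
   polynomial at a time. *)

(** * Limits of complex sequences and matrices, taken componentwise *)

Section ComplexLimits.
Variable R : realType.
Local Notation C := R[i].
Local Notation Re := (@complex.Re R).
Local Notation Im := (@complex.Im R).

Lemma complexReD (x y : C) : Re (x + y) = Re x + Re y.
Proof. by case: x y => [a b] [c d]. Qed.
Lemma complexImD (x y : C) : Im (x + y) = Im x + Im y.
Proof. by case: x y => [a b] [c d]. Qed.
Lemma complexReM (x y : C) : Re (x * y) = Re x * Re y - Im x * Im y.
Proof. by case: x y => [a b] [c d]. Qed.
Lemma complexImM (x y : C) : Im (x * y) = Re x * Im y + Im x * Re y.
Proof. by case: x y => [a b] [c d]. Qed.
Lemma complexRe_sum (I : Type) (s : seq I) (P : pred I) (F : I -> C) :
  Re (\sum_(i <- s | P i) F i) = \sum_(i <- s | P i) Re (F i).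
Proof. by apply: (big_morph Re complexReD). Qed.
Lemma complexIm_sum (I : Type) (s : seq I) (P : pred I) (F : I -> C) :
  Im (\sum_(i <- s | P i) F i) = \sum_(i <- s | P i) Im (F i).
Proof. by apply: (big_morph Im complexImD). Qed.
Lemma complexReJ (x : C) : Re (conjc x) = Re x.
Proof. by case: x. Qed.
Lemma complexImJ (x : C) : Im (conjc x) = - Im x.
Proof. by case: x. Qed.

(** Real and imaginary parts are kept apart because [phimx] and [ip] are defined by two separate
    real limits, which [ccvg_lim] reassembles. *)
Definition ccvg (u : nat -> C) (l : C) : Prop :=
  (fun n => Re (u n)) @ \oo --> Re l /\ (fun n => Im (u n)) @ \oo --> Im l.

Lemma ccvg_lim u l : ccvg u l ->
  Complex (slim (fun n => Re (u n))) (slim (fun n => Im (u n))) = l.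
Proof.
move=> [ur ui]; rewrite /slim; case: l ur ui => a b /= ur ui.
by congr Complex; apply/cvg_lim.
Qed.

Lemma ccvg_unique u l l' : ccvg u l -> ccvg u l' -> l = l'.
Proof. by move=> /ccvg_lim <- /ccvg_lim. Qed.

Lemma ccvg_cst l : ccvg (fun=> l) l.
Proof. by split; apply: cvg_cst. Qed.

Lemma ccvgD u v l l' : ccvg u l -> ccvg v l' -> ccvg (fun n => u n + v n) (l + l').
Proof.
move=> [ur ui] [vr vi]; split.
  by rewrite complexReD; under eq_fun do rewrite complexReD; apply: cvgD.
by rewrite complexImD; under eq_fun do rewrite complexImD; apply: cvgD.
Qed.

Lemma ccvgM u v l l' : ccvg u l -> ccvg v l' -> ccvg (fun n => u n * v n) (l * l').
Proof.
move=> [ur ui] [vr vi]; split.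
  rewrite complexReM; under eq_fun do rewrite complexReM.
  by apply: cvgB; apply: cvgM.
rewrite complexImM; under eq_fun do rewrite complexImM.
by apply: cvgD; apply: cvgM.
Qed.

Lemma ccvgN u l : ccvg u l -> ccvg (fun n => - u n) (- l).
Proof.
move=> ul; rewrite -mulN1r; under eq_fun do rewrite -mulN1r.
exact: ccvgM (ccvg_cst _) ul.
Qed.

Lemma ccvg_sum (I : Type) (s : seq I) (u : I -> nat -> C) (l : I -> C) :
  (forall i, ccvg (u i) (l i)) ->
  ccvg (fun n => \sum_(i <- s) u i n) (\sum_(i <- s) l i).
Proof.
move=> ul; elim: s => [|i s IH].
  by rewrite big_nil; under eq_fun do rewrite big_nil; apply: ccvg_cst.
rewrite big_cons; under eq_fun do rewrite big_cons.
exact: ccvgD.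
Qed.

Lemma ccvgS u l : ccvg (fun n => u n.+1) l -> ccvg u l.
Proof.
by move=> [ur ui]; split; [rewrite -(cvg_shiftS (fun n => Re (u n)))|
  rewrite -(cvg_shiftS (fun n => Im (u n)))].
Qed.

Lemma ccvg_succ u l : ccvg u l -> ccvg (fun n => u n.+1) l.
Proof.
by move=> [ur ui]; split; [rewrite (cvg_shiftS (fun n => Re (u n)))|
  rewrite (cvg_shiftS (fun n => Im (u n)))].
Qed.

Definition mcvg m n (u : nat -> 'M[C]_(m, n)) (l : 'M[C]_(m, n)) : Prop :=
  forall i j, ccvg (fun p => u p i j) (l i j).

Lemma mcvg_cst m n (l : 'M[C]_(m, n)) : mcvg (fun=> l) l.
Proof. by move=> i j; apply: ccvg_cst. Qed.

Lemma mcvgM m n p (u : nat -> 'M[C]_(m, n)) (v : nat -> 'M[C]_(n, p)) l l' :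
  mcvg u l -> mcvg v l' -> mcvg (fun k => u k *m v k) (l *m l').
Proof.
move=> ul vl i j; rewrite mxE; under eq_fun do rewrite mxE.
by apply: ccvg_sum => k; apply: ccvgM.
Qed.

Lemma exp_dominated_cvg (u : nat -> R) (K : R) :
  (forall k, `|u k| <= K ^+ k / k`!%:R) -> cvgn (fun n => \sum_(k < n) u k).
Proof.
move=> uK.
have -> : (fun n => \sum_(k < n) u k) = series u.
  by apply/funext => n; rewrite seriesEord.
apply: normed_cvg; apply: (@series_le_cvg _ _ (exp_coeff K)) => //.
- by move=> k; rewrite /= normr_ge0.
- by move=> k; apply: le_trans (uK k).
- exact: is_cvg_series_exp_coeff.
Qed.

End ComplexLimits.

(** * Entrywise bounds for matrix powers and convergence of the series phi *)

Lemma expmx_entry_bound (F : numDomainType) n (M : 'M[F]_n) :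
  exists2 K : F, 0 <= K & forall k i j, `|(M ^+ k) i j| <= K ^+ k.
Proof.
(* The sum of the moduli of all entries dominates each row sum, so one more multiplication by [M]
   costs at most one factor [K]. *)
exists (\sum_i \sum_j `|M i j|).
  by apply: sumr_ge0 => i _; apply: sumr_ge0.
elim=> [|k IH] i j; first by rewrite !expr0 mxE; case: (i == j); rewrite ?normr1 ?normr0 ?ler01.
rewrite exprS mxE (le_trans (ler_norm_sum _ _ _))// exprS.
apply: (@le_trans _ _ ((\sum_l `|M i l|) * (\sum_i \sum_j `|M i j|) ^+ k)).
  rewrite mulr_suml; apply: ler_sum => l _.
  by rewrite normrM ler_wpM2l.
apply: ler_wpM2r.
  by apply: exprn_ge0; apply: sumr_ge0 => ? _; apply: sumr_ge0.
rewrite [leRHS](bigD1 i)//= lerDl.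
by apply: sumr_ge0 => ? _; apply: sumr_ge0.
Qed.

Section Phi.
Variable R : realType.
Local Notation C := R[i].
Local Notation Re := (@complex.Re R).
Local Notation Im := (@complex.Im R).

Lemma normc_ge_Im (x : C) : `|Im x|%:C%C <= `|x|.
Proof.
by case: x => a b; simpc; rewrite -sqrtr_sqr ler_wsqrtr // lerDr sqr_ge0.
Qed.

Lemma phi_partial_cvg n (M : 'M[C]_n) :
  mcvg (fun p => \sum_(k < p) ((k.+1)`!%:R)^-1 *: M ^+ k) (phimx M).
Proof.
have [K K0 MK] := expmx_entry_bound M.
(* The norm on [C] is itself [C]-valued, so [K] must be recognised as real before its real part can
   serve as a bound. *)
have KE : K = (Re K)%:C%C by move: K0; case: (K) => a b; rewrite lecE /= => /andP[/eqP-> _].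
have Kr0 : 0 <= Re K by move: K0; rewrite {1}KE lecR.
have bR k i j : `|Re ((M ^+ k) i j)| <= Re K ^+ k.
  have := le_trans (normc_ge_Re _) (MK k i j).
  by rewrite {1}KE -rmorphXn lecR.
have bI k i j : `|Im ((M ^+ k) i j)| <= Re K ^+ k.
  have := le_trans (normc_ge_Im _) (MK k i j).
  by rewrite {1}KE -rmorphXn lecR.
have coefE (k : nat) (z : C) : ((k.+1)`!%:R)^-1 * z = ((k.+1)`!%:R^-1)%:C%C * z.
  by rewrite fmorphV rmorph_nat.
have dom (k : nat) (x : R) : `|x| <= Re K ^+ k ->
    `|(k.+1)`!%:R^-1 * x| <= Re K ^+ k / k`!%:R.
  move=> xK; rewrite normrM mulrC (@ger0_norm _ (_^-1)) ?invr_ge0 ?ler0n//.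
  apply: ler_pM => //.
  by rewrite lef_pV2 ?posrE ?ltr0n ?fact_gt0// ler_nat factS leq_pmull.
have partE p i j : (\sum_(k < p) ((k.+1)`!%:R)^-1 *: M ^+ k) i j =
    \sum_(k < p) ((k.+1)`!%:R^-1)%:C%C * (M ^+ k) i j.
  by rewrite summxE; apply: eq_bigr => k _; rewrite mxE coefE.
move=> i j; rewrite mxE; split => /=.
  suff : cvgn (fun p => Re ((\sum_(k < p) ((k.+1)`!%:R)^-1 *: M ^+ k) i j)) by [].
  under eq_fun do rewrite partE complexRe_sum.
  apply: (@exp_dominated_cvg _ (fun k => Re (((k.+1)`!%:R^-1)%:C%C * (M ^+ k) i j)) (Re K)) => k.
  by rewrite complexReM /= mul0r subr0; apply/dom/bR.
suff : cvgn (fun p => Im ((\sum_(k < p) ((k.+1)`!%:R)^-1 *: M ^+ k) i j)) by [].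
under eq_fun do rewrite partE complexIm_sum.
apply: (@exp_dominated_cvg _ (fun k => Im (((k.+1)`!%:R^-1)%:C%C * (M ^+ k) i j)) (Re K)) => k.
by rewrite complexImM /= mul0r addr0; apply/dom/bI.
Qed.
End Phi.

(** * Square-summable sequences and their inner product *)

Section SquareSummable.
Variable R : realType.
Local Notation C := R[i].
Local Notation Re := (@complex.Re R).
Local Notation Im := (@complex.Im R).

Lemma bounded_dominated_cvg (u v : nat -> R) (M : R) :
  (forall k, `|u k| <= v k) -> (forall p, \sum_(k < p) v k <= M) ->
  cvgn (fun n => \sum_(k < n) u k).
Proof.
move=> uv vM.
have v0 k : 0 <= v k by apply: le_trans (uv k).
have -> : (fun n => \sum_(k < n) u k) = series u.
  by apply/funext => n; rewrite seriesEord.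
apply: normed_cvg; apply: (@series_le_cvg _ _ v) => //.
- by move=> k; rewrite /= normr_ge0.
- apply: nondecreasing_is_cvgn.
    by apply: nondecreasing_series => n _ _; exact: v0.
  by exists M => _ [n _ <-]; rewrite seriesEord; apply: vM.
Qed.

Lemma sqn_ge0 n (v : 'cV[C]_n) : 0 <= sqn v.
Proof. by apply: sumr_ge0 => i _; rewrite addr_ge0 ?sqr_ge0. Qed.

Lemma adj_mulE n (x y : 'cV[C]_n) :
  (adj x *m y) 0 0 = \sum_i conjc (x i 0) * y i 0.
Proof. by rewrite mxE; apply: eq_bigr => i _; rewrite !mxE. Qed.

(** Both parts of conj(x) y have the shape a c + b d up to signs, so this one bound serves for each.
    The constant 1 in place of 1/2 is harmless, since only summability is at stake. *)
Lemma norm_mulD_le (a b c d : R) :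
  `|a * c + b * d| <= a ^+ 2 + b ^+ 2 + (c ^+ 2 + d ^+ 2).
Proof.
have h1 := sqr_ge0 (a - c); have h2 := sqr_ge0 (a + c).
have h3 := sqr_ge0 (b - d); have h4 := sqr_ge0 (b + d).
have h5 := sqr_ge0 a; have h6 := sqr_ge0 b; have h7 := sqr_ge0 c.
have h8 := sqr_ge0 d.
by rewrite ler_norml; apply/andP; split; nra.
Qed.

Lemma inner_Re_le n (x y : 'cV[C]_n) :
  `|Re ((adj x *m y) 0 0)| <= sqn x + sqn y.
Proof.
rewrite adj_mulE complexRe_sum (le_trans (ler_norm_sum _ _ _))//.
rewrite /sqn -big_split /=; apply: ler_sum => i _.
by rewrite complexReM complexReJ complexImJ mulNr opprK norm_mulD_le.
Qed.

Lemma inner_Im_le n (x y : 'cV[C]_n) :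
  `|Im ((adj x *m y) 0 0)| <= sqn x + sqn y.
Proof.
rewrite adj_mulE complexIm_sum (le_trans (ler_norm_sum _ _ _))//.
rewrite /sqn -big_split /=; apply: ler_sum => i _.
rewrite complexImM complexReJ complexImJ mulNr -mulrN [leRHS]addrC.
rewrite -[Re (y i 0) ^+ 2](sqrrN (Re (y i 0))) -[X in _ <= X + _]addrC [leRHS]addrC.
exact: norm_mulD_le.
Qed.

Lemma ip_cvg n (x y : Xs R n) : l2 x -> l2 y ->
  ccvg (fun p => \sum_(k < p) (adj (x k) *m y k) 0 0) (ip x y).
Proof.
move=> [M xM] [M' yM].
have sM p : \sum_(k < p) (sqn (x k) + sqn (y k)) <= M + M'.
  by rewrite big_split lerD.
split => /=.
  suff : cvgn (fun p => Re (\sum_(k < p) (adj (x k) *m y k) 0 0)) by [].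
  under eq_fun do rewrite complexRe_sum.
  apply: (@bounded_dominated_cvg (fun k => Re ((adj (x k) *m y k) 0 0)) _ _ _ sM) => k.
  exact: inner_Re_le.
suff : cvgn (fun p => Im (\sum_(k < p) (adj (x k) *m y k) 0 0)) by [].
under eq_fun do rewrite complexIm_sum.
apply: (@bounded_dominated_cvg (fun k => Im ((adj (x k) *m y k) 0 0)) _ _ _ sM) => k.
exact: inner_Im_le.
Qed.

Lemma ip_eq n (x y : Xs R n) l :
  ccvg (fun p => \sum_(k < p) (adj (x k) *m y k) 0 0) l -> ip x y = l.
Proof. exact: ccvg_lim. Qed.

(** The k-th term is a difference of two consecutive partial sums with the same limit. This discards
    the boundary term left when [Aop] is moved across the inner product. *)
Lemma inner_cvg0 n (x y : Xs R n) : l2 x -> l2 y ->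
  ccvg (fun k => (adj (x k) *m y k) 0 0) 0.
Proof.
move=> x2 y2; have xy := ip_cvg x2 y2.
rewrite -(subrr (ip x y)).
have -> : (fun k => (adj (x k) *m y k) 0 0) =
  (fun k => \sum_(j < k.+1) (adj (x j) *m y j) 0 0 - \sum_(j < k) (adj (x j) *m y j) 0 0).
  by apply/funext => k; rewrite big_ord_recr /= addrAC subrr add0r.
apply: ccvgD; last exact: ccvgN.
exact: ccvg_succ xy.
Qed.

Lemma l2D n (x y : nat -> 'cV[C]_n) : l2 x -> l2 y -> l2 (fun k => x k + y k).
Proof.
move=> [M xM] [M' yM]; exists (2 * M + 2 * M') => p.
apply: (@le_trans _ _ (\sum_(k < p) (2 * sqn (x k) + 2 * sqn (y k)))).
  apply: ler_sum => k _; rewrite /sqn !mulr_sumr -big_split /=.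
  apply: ler_sum => i _; rewrite !mxE complexReD complexImD.
  have := sqr_ge0 (Re (x k i 0) - Re (y k i 0)).
  by have := sqr_ge0 (Im (x k i 0) - Im (y k i 0)); nra.
by rewrite big_split -!mulr_sumr lerD// ler_pM2l.
Qed.

Lemma sqnZ n (a : C) (v : 'cV[C]_n) : sqn (a *: v) = (Re a ^+ 2 + Im a ^+ 2) * sqn v.
Proof.
rewrite /sqn mulr_sumr; apply: eq_bigr => i _.
by rewrite !mxE complexReM complexImM; ring.
Qed.

Lemma l2N n (x : nat -> 'cV[C]_n) : l2 x -> l2 (fun k => - x k).
Proof.
move=> [M xM]; exists M => p; rewrite (le_trans _ (xM p))//.
by apply: ler_sum => k _; rewrite -scaleN1r sqnZ /= oppr0 expr0n addr0 sqrrN expr1n mul1r.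
Qed.

Lemma l2_mulmx n q (P : 'M[C]_(q, n)) (x : nat -> 'cV[C]_n) :
  l2 x -> l2 (fun k => P *m x k).
Proof.
move=> [M xM].
(* Splitting along the columns of [P] leaves sequences whose norms [sqnZ] computes exactly, so no
   operator norm has to be estimated. *)
have -> : (fun k => P *m x k) = (fun k => \sum_j x k j 0 *: col j P).
  apply/funext => k; apply/matrixP => i j; rewrite mxE summxE ord1.
  by apply: eq_bigr => l _; rewrite !mxE mulrC.
have colP j : l2 (fun k => x k j 0 *: col j P).
  exists (M * sqn (col j P)) => p.
  under eq_bigr do rewrite sqnZ.
  rewrite -mulr_suml ler_wpM2r ?sqn_ge0// (le_trans _ (xM p))//.
  apply: ler_sum => k _; rewrite /sqn [leRHS](bigD1 j)//= lerDl.
  by apply: sumr_ge0 => i _; rewrite addr_ge0 ?sqr_ge0.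
elim: (index_enum _) => [|j s IH].
  exists 0 => p; rewrite big1// => k _; rewrite big_nil /sqn big1// => i _.
  by rewrite mxE /= expr0n addr0.
under eq_fun do rewrite big_cons.
exact: l2D.
Qed.

Lemma l2S n (x : nat -> 'cV[C]_n) : l2 x -> l2 (fun k => x k.+1).
Proof.
move=> [M xM]; exists M => p; have := xM p.+1.
by rewrite big_ord_recl /=; apply: le_trans; rewrite lerDr sqn_ge0.
Qed.

Lemma bddXX_l2 n (T : Xs R n -> Xs R n) x : bddXX T -> l2 x -> l2 (T x).
Proof. by move=> [c Tc] [M xM]; exists (c * M); apply: Tc. Qed.

End SquareSummable.

(** * Exponential decay and integration over the half-line *)

Section ExponentialDecay.
Variable R : realType.
Implicit Types (f g F : R -> R).

(** The first component of [Ce] is the constant, the second the rate. *)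
Definition edecay f : Prop :=
  exists Ce : R * R, 0 < Ce.2 /\ forall t, 0 <= t -> `|f t| <= Ce.1 * expR (- (Ce.2 * t)).

Lemma edecay_coef_ge0 f (C e : R) :
  (forall t, 0 <= t -> `|f t| <= C * expR (- (e * t))) -> 0 <= C.
Proof.
move=> /(_ 0 (lexx _)) /(le_trans (normr_ge0 _)).
by rewrite mulr0 oppr0 expR0 mulr1.
Qed.

Lemma edecay0 : edecay (fun=> 0).
Proof. by exists (0, 1); split => //= t _; rewrite normr0 mul0r. Qed.

Lemma edecayD f g : edecay f -> edecay g -> edecay (fun t => f t + g t).
Proof.
move=> [[C e] /= [e0 fC]] [[C' e'] /= [e'0 gC]].
have C0 := edecay_coef_ge0 fC.
have C'0 := edecay_coef_ge0 gC.
exists (C + C', Num.min e e'); split => /=; first by rewrite lt_min e0.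
move=> t t0; rewrite (le_trans (ler_normD _ _))// mulrDl lerD//.
  rewrite (le_trans (fC t t0))// ler_wpM2l// ler_expR lerN2 ler_wpM2r//.
  by rewrite ge_min lexx.
rewrite (le_trans (gC t t0))// ler_wpM2l// ler_expR lerN2 ler_wpM2r//.
by rewrite ge_min lexx orbT.
Qed.

Lemma edecayZ (k : R) f : edecay f -> edecay (fun t => k * f t).
Proof.
move=> [[C e] /= [e0 fC]]; exists (`|k| * C, e); split => //= t t0.
by rewrite normrM -mulrA ler_wpM2l// fC.
Qed.

Lemma edecay_sum (I : Type) (s : seq I) (f : I -> R -> R) :
  (forall i, edecay (f i)) -> edecay (fun t => \sum_(i <- s) f i t).
Proof.
move=> fd; elim: s => [|i s IH].
  by under eq_fun do rewrite big_nil; apply: edecay0.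
by under eq_fun do rewrite big_cons; apply: edecayD.
Qed.

Lemma edecay_le f g : (forall t, `|f t| <= g t) -> edecay g -> edecay f.
Proof.
move=> fg [[C e] /= [e0 gC]]; exists (C, e); split => //= t t0.
by rewrite (le_trans (fg t))// (le_trans (ler_norm _))// gC.
Qed.

(** The hypotheses concern squares because the energy estimate [edecay_forced] controls |u|^2 and
    not u itself; |f g| <= f^2 + g^2 then suffices. *)
Lemma edecay_mul f g :
  edecay (fun t => f t ^+ 2) -> edecay (fun t => g t ^+ 2) ->
  edecay (fun t => f t * g t).
Proof.
move=> fd gd; apply: edecay_le (edecayD fd gd) => t.
have h1 := sqr_ge0 (f t - g t); have h2 := sqr_ge0 (f t + g t).
have h3 := sqr_ge0 (f t); have h4 := sqr_ge0 (g t).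
by rewrite ler_norml; apply/andP; split; nra.
Qed.

Lemma cvg_expRN (e : R) : 0 < e -> expR (- (e * t)) @[t --> +oo] --> (0 : R).
Proof.
move=> e0; apply: (@cvg_comp _ _ _ (fun t => e * t) (fun x => expR (- x)) _ _ _ _ (@cvgr_expR R)).
apply/cvgryPge => A; near=> t; rewrite -ler_pdivrMl//; near: t.
Unshelve. all: end_near. Qed.

Lemma edecay_cvg0 f : edecay f -> f t @[t --> +oo] --> (0 : R).
Proof.
move=> [[C e] /= [e0 fC]]; apply/norm_cvg0P.
apply: (@squeeze_cvgr _ _ _ _ (fun=> 0) (fun t => C * expR (- (e * t)))).
- near=> t; rewrite normr_ge0 fC//.
- exact: cvg_cst.
- by rewrite -(mulr0 C); apply: cvgMr => //; exact: cvg_expRN.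
Unshelve. all: end_near. Qed.

Lemma is_deriveDf f g (t a b : R) :
  is_derive t 1 f a -> is_derive t 1 g b -> is_derive t 1 (fun x => f x + g x) (a + b).
Proof. exact: is_deriveD. Qed.

Lemma is_deriveMf f g (t a b : R) :
  is_derive t 1 f a -> is_derive t 1 g b ->
  is_derive t 1 (fun x => f x * g x) (a * g t + f t * b).
Proof.
move=> df dg; have := is_deriveM df dg.
rewrite /GRing.scale /= addrC [g t * a]mulrC; exact.
Qed.

Lemma is_deriveZf f (k t a : R) :
  is_derive t 1 f a -> is_derive t 1 (fun x => k * f x) (k * a).
Proof. exact: is_deriveZ. Qed.

Lemma is_derive_sumf (I : Type) (s : seq I) (f : I -> R -> R) (a : I -> R) (t : R) :
  (forall i, is_derive t 1 (f i) (a i)) ->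
  is_derive t 1 (fun x => \sum_(i <- s) f i x) (\sum_(i <- s) a i).
Proof.
move=> df; elim: s => [|i s IH].
  by rewrite big_nil; under eq_fun do rewrite big_nil; exact: is_derive_cst.
rewrite big_cons; under eq_fun do rewrite big_cons.
exact: is_deriveDf.
Qed.

Lemma is_derive_expRM (c t : R) : is_derive t 1 (fun t => expR (c * t)) (c * expR (c * t)).
Proof.
have dc : is_derive t 1 (fun t => c * t) (c * 1) by exact: is_deriveZf (is_derive_id _ _).
have := is_derive1_comp (is_derive_expR (c * t)) dc.
by rewrite mulr1 mulrC.
Qed.

Lemma is_derive_continuous f (f' : R -> R) : (forall t : R, is_derive t 1 f (f' t)) -> continuous f.
Proof.
move=> df t; apply: differentiable_continuous; apply/derivable1_diffP.
by have [] := df t.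
Qed.

(* The energy |u|^2 of a solution of u' = (a + ib) u + g satisfies
   h' <= a h + |g|^2 / (-a), so exp(e' t) h plus a multiple of exp(-(e - e') t)
   is nonincreasing as soon as e' <= -a and e' < e. *)
Lemma edecay_forced (p q g1 g2 : R -> R) (a b : R) : a < 0 ->
  (forall t : R, is_derive t 1 p (a * p t - b * q t + g1 t)) ->
  (forall t : R, is_derive t 1 q (b * p t + a * q t + g2 t)) ->
  edecay (fun t => g1 t ^+ 2 + g2 t ^+ 2) ->
  edecay (fun t => p t ^+ 2 + q t ^+ 2).
Proof.
move=> a0 dp dq [[C e] /= [e0 gC]].
set e' := Num.min (- a) (e / 2).
have e'0 : 0 < e' by rewrite lt_min oppr_gt0 a0 divr_gt0.
have e'a : e' <= - a by rewrite ge_min lexx.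
have e'e : e' < e.
  by rewrite gt_min; apply/orP; right; rewrite ltr_pdivrMr// ltr_pMr// ltr1n.
have ee' : 0 < e - e' by rewrite subr_gt0.
have C0 := edecay_coef_ge0 gC.
(* [D] is tuned so that the derivative of the second term of [Phi] exactly cancels the forcing
   contribution [expR (e' * t) * (C / (- a) * expR (- (e * t)))]. *)
pose D := C / (- a) / (e - e').
pose h (t : R) : R := p t * p t + q t * q t.
pose Phi (t : R) : R := expR (e' * t) * h t + D * expR (- (e - e') * t).
pose dh (t : R) : R := (a * p t - b * q t + g1 t) * p t + p t * (a * p t - b * q t + g1 t)
   + ((b * p t + a * q t + g2 t) * q t + q t * (b * p t + a * q t + g2 t)).
pose dPhi (t : R) : R := (e' * expR (e' * t) * h t + expR (e' * t) * dh t)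
   + D * (- (e - e') * expR (- (e - e') * t)).
have dPhiE (t : R) : is_derive t 1 Phi (dPhi t).
  apply: is_deriveDf; last exact/is_deriveZf/is_derive_expRM.
  apply: is_deriveMf; first exact: is_derive_expRM.
  by apply: is_deriveDf; apply: is_deriveMf.
have dh_le t : 0 <= t -> dh t <= a * h t + C / (- a) * expR (- (e * t)).
  move=> t0.
  have G : g1 t ^+ 2 + g2 t ^+ 2 <= C * expR (- (e * t)).
    by apply: le_trans (gC t t0); apply: ler_norm.
  rewrite -mulrA mulrCA.
  have : a * h t + (- a)^-1 * (g1 t ^+ 2 + g2 t ^+ 2) <=
      a * h t + (- a)^-1 * (C * expR (- (e * t))).
    by rewrite lerD2l ler_wpM2l// invr_ge0 oppr_ge0 ltW.
  rewrite (mulrCA _ C); apply: le_trans; rewrite -subr_ge0.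
  (* Completing the square: the slack in the differential inequality is |a u + g|^2 / (-a), with u =
     (p, q) and g = (g1, g2). *)
  have -> : a * h t + (- a)^-1 * (g1 t ^+ 2 + g2 t ^+ 2) - dh t =
     (- a)^-1 * ((a * p t + g1 t) ^+ 2 + (a * q t + g2 t) ^+ 2).
    rewrite /h /dh; field; lra.
  by rewrite mulr_ge0 ?invr_ge0 ?oppr_ge0 ?(ltW a0)// addr_ge0 ?sqr_ge0.
have dPhi_le t : 0 <= t -> dPhi t <= 0.
  move=> t0; rewrite /dPhi.
  have h0 : 0 <= h t by rewrite /h -!expr2 addr_ge0 ?sqr_ge0.
  have -> : expR (- (e - e') * t) = expR (e' * t) * expR (- (e * t)).
    by rewrite -expRD; congr expR; ring.
  have E0 := expR_gt0 (e' * t).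
  have -> : D * (- (e - e') * (expR (e' * t) * expR (- (e * t)))) =
     - (expR (e' * t) * (C / (- a) * expR (- (e * t)))).
    by rewrite /D; field; rewrite ?oppr_eq0; apply/andP; split; lra.
  have -> : e' * expR (e' * t) * h t = expR (e' * t) * (e' * h t) by ring.
  rewrite -mulrDr -mulrBr pmulr_rle0//.
  have := dh_le t t0.
  have : (e' + a) * h t <= 0 by rewrite mulr_le0_ge0//; lra.
  by lra.
have Phi_le t : 0 <= t -> Phi t <= Phi 0.
  move=> t0; apply: (@ler0_derive1_nincry _ Phi 0) => //.
  - move=> x; rewrite in_itv /= andbT => x0.
    by rewrite derive1E; have [_ ->] := dPhiE x; exact/dPhi_le/ltW.
  - by apply: continuous_subspaceT; apply: is_derive_continuous dPhiE.
exists (Phi 0, e'); split => //= t t0.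
rewrite ger0_norm ?addr_ge0 ?sqr_ge0// expRN ler_pdivlMr ?expR_gt0//.
apply: le_trans (Phi_le t t0); rewrite /Phi /h -!expr2 mulrC lerDl.
rewrite mulr_ge0 ?expR_ge0// /D !divr_ge0// ?oppr_ge0 ltW//.
Qed.

Lemma expRN_integral (C e : R) : 0 <= C -> 0 < e ->
  (\int[lebesgue_measure]_(t in `[0%R, +oo[) (C * expR (- e * t))%:E = (C / e)%:E)%E.
Proof.
move=> C0 e0; pose F (t : R) : R := - (C / e) * expR (- e * t).
have dF (t : R) : is_derive t 1 F (C * expR (- e * t)).
  have -> : C * expR (- e * t) = - (C / e) * (- e * expR (- e * t)).
    by field; lra.
  exact/is_deriveZf/is_derive_expRM.
have cF : continuous F by apply: is_derive_continuous dF.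
rewrite (@ge0_continuous_FTC2y _ _ F 0 0).
- by rewrite /F mulr0 expR0 mulr1 -EFinB sub0r opprK.
- by move=> x _; rewrite mulr_ge0// expR_ge0.
- apply: continuous_subspaceT.
  apply: (@is_derive_continuous _ (fun t => C * (- e * expR (- e * t)))) => t.
  exact/is_deriveZf/is_derive_expRM.
- rewrite /F -(mulr0 (- (C / e))); apply: cvgMr.
  by under eq_fun do rewrite mulNr; exact: cvg_expRN.
- by move=> x _; have [] := dF x.
- exact: cvg_at_right_filter (cF 0).
- by move=> x _; rewrite derive1E; have [_ ->] := dF x.
Qed.

Lemma expRN_integrable (C e : R) : 0 <= C -> 0 < e ->
  (@lebesgue_measure R).-integrable `[0, +oo[%classic
    (EFin \o (fun t => C * expR (- e * t))).
Proof.
move=> C0 e0; apply/integrableP; split.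
  apply/measurable_EFinP; apply: measurable_funTS.
  apply: continuous_measurable_fun.
  apply: (@is_derive_continuous _ (fun t => C * (- e * expR (- e * t)))) => t.
  exact/is_deriveZf/is_derive_expRM.
under eq_integral do rewrite /= ger0_norm ?mulr_ge0 ?expR_ge0//.
by rewrite expRN_integral// ltry.
Qed.

Lemma edecay_integrable f : continuous f -> edecay f ->
  (@lebesgue_measure R).-integrable `[0, +oo[%classic (EFin \o f).
Proof.
move=> cf [[C e] /= [e0 fC]].
have C0 := edecay_coef_ge0 fC.
apply: (le_integrable _ _ _ (expRN_integrable C0 e0)) => //.
  apply/measurable_EFinP; apply: measurable_funTS.
  exact: continuous_measurable_fun.
move=> t; rewrite /= in_itv /= andbT => t0.
rewrite lee_fin [leRHS]ger0_norm ?mulr_ge0 ?expR_ge0// mulNr.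
exact: fC.
Qed.

(* Adding the dominating exponential to f makes the integrand nonnegative, which is
   what the fundamental theorem on a half-line asks for. *)
Lemma edecay_FTC f F : continuous f -> edecay f -> edecay F ->
  (forall t : R, is_derive t 1 F (f t)) ->
  \int[lebesgue_measure]_(t in `[0, +oo[) f t = - F 0.
Proof.
move=> cf fd Fd dF; have if_ := edecay_integrable cf fd.
move: fd => [[C e] /= [e0 fC]].
have C0 := edecay_coef_ge0 fC.
have ig := expRN_integrable C0 e0.
have Ig : \int[lebesgue_measure]_(t in `[0, +oo[) (C * expR (- e * t)) = C / e.
  by rewrite /Rintegral expRN_integral.
have dE (t : R) : is_derive t 1 (fun t => - (C / e) * expR (- e * t)) (C * expR (- e * t)).
  have -> : C * expR (- e * t) = - (C / e) * (- e * expR (- e * t)).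
    by field; lra.
  exact/is_deriveZf/is_derive_expRM.
have dG (t : R) : is_derive t 1 (fun t => F t + - (C / e) * expR (- e * t))
    (f t + C * expR (- e * t)) by apply: is_deriveDf.
have cG := is_derive_continuous dG.
have cE : continuous (fun t => C * expR (- e * t)).
  apply: (@is_derive_continuous _ (fun t => C * (- e * expR (- e * t)))) => t.
  exact/is_deriveZf/is_derive_expRM.
have := @Rintegral_ge0_continuous_FTC2y _ (fun t => f t + C * expR (- e * t))
  (fun t => F t + - (C / e) * expR (- e * t)) 0 0.
rewrite RintegralD// Ig mulr0 expR0 mulr1 => H.
have {H} : \int[lebesgue_measure]_(t in `[0, +oo[) f t + C / e = 0 - (F 0 - C / e).
  apply: H.
  - by move=> x x0; have := fC x x0; rewrite ler_norml mulNr => /andP[]; lra.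
  - by apply: continuous_subspaceT => x; apply: cvgD; [exact: cf|exact: cE].
  - rewrite -[X in _ --> X](addr0 0); apply: cvgD; first exact: edecay_cvg0.
    rewrite -(mulr0 (- (C / e))); apply: cvgMr.
    by under eq_fun do rewrite mulNr; exact: cvg_expRN.
  - by move=> x _; have [] := dG x.
  - by have := cvg_at_right_filter (cG 0); rewrite mulr0 expR0 mulr1.
  - by move=> x _; rewrite derive1E; have [_ ->] := dG x.
by lra.
Qed.

End ExponentialDecay.

(** * The matrix exponential: derivative and decay *)

Lemma cvgn_sum (R : realType) (I : Type) (s : seq I) (u : I -> nat -> R) (l : I -> R) :
  (forall i, u i @ \oo --> l i) ->
  (fun n => \sum_(i <- s) u i n) @ \oo --> \sum_(i <- s) l i.
Proof.
move=> ul; elim: s => [|i s IH].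
  by rewrite big_nil; under eq_fun do rewrite big_nil; apply: cvg_cst.
rewrite big_cons; under eq_fun do rewrite big_cons.
exact: cvgD.
Qed.

Section MatrixExponential.
Variable R : realType.
Local Notation C := R[i].
Local Notation Re := (@complex.Re R).
Local Notation Im := (@complex.Im R).
Variable n' : nat.
Local Notation n := n'.+1.
Variable A : 'M[R]_n.

(** Taylor coefficients of the entries of P exp(tA). Carrying the left factor [P] makes termwise
    differentiation the replacement of [P] by [P *m A], so the family is closed under
    [pseries_diffs]. *)
Definition expcoef (P : 'M[R]_n) i j (k : nat) : R := (k`!%:R)^-1 * (P *m A ^+ k) i j.

Lemma expcoef_diffs P i j : pseries_diffs (expcoef P i j) = expcoef (P *m A) i j.
Proof.
apply/funext => k; rewrite /pseries_diffs /expcoef factS natrM invfM mulrA.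
by rewrite mulVKf ?pnatr_eq0// exprS -mulmxE mulmxA.
Qed.

Lemma expm_entry (t : R) i j : expmR (t *: A) i j = limn (pseries (expcoef 1%:M i j) t).
Proof.
rewrite mxE -[RHS]/(slim _); congr slim; apply/funext => p.
rewrite /pseries seriesEord summxE; apply: eq_bigr => k _.
by rewrite /= /expcoef mul1mx !mxE exprZn mxE mulrA mulrAC.
Qed.

Lemma expm_pseries1_cvg (t : R) i j : cvgn (pseries (expcoef 1%:M i j) t).
Proof.
have [K K0 AK] := expmx_entry_bound A.
have -> : pseries (expcoef 1%:M i j) t = (fun p => \sum_(k < p) expcoef 1%:M i j k * t ^+ k).
  by apply/funext => p; rewrite /pseries seriesEord.
apply: (@exp_dominated_cvg _ (fun k => expcoef 1%:M i j k * t ^+ k) (K * `|t|)) => k.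
rewrite /expcoef mul1mx !normrM normrX exprMn.
rewrite (@ger0_norm _ (_^-1)) ?invr_ge0 ?ler0n//.
rewrite -mulrA [leLHS]mulrC ler_wpM2r ?invr_ge0 ?ler0n//.
by rewrite ler_wpM2r ?exprn_ge0.
Qed.

Lemma expm_pseries_cvgto P (t : R) i j :
  pseries (expcoef P i j) t @ \oo --> (P *m expmR (t *: A)) i j.
Proof.
have -> : pseries (expcoef P i j) t =
    (fun p => \sum_l P i l * pseries (expcoef 1%:M l j) t p).
  apply/funext => p; rewrite /pseries seriesEord.
  under [RHS]eq_bigr do rewrite seriesEord mulr_sumr.
  rewrite exchange_big; apply: eq_bigr => k _.
  rewrite /= /expcoef mxE mulr_sumr mulr_suml; apply: eq_bigr => l _.
  by rewrite mul1mx; ring.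
rewrite mxE; apply: cvgn_sum => l; apply: cvgMr.
by rewrite expm_entry; exact: expm_pseries1_cvg.
Qed.

Lemma expm_derive (P : 'M[R]_n) (t : R) i j :
  is_derive t 1 (fun t : R => (P *m expmR (t *: A)) i j) ((P *m A *m expmR (t *: A)) i j).
Proof.
have E Q (x : R) : (Q *m expmR (x *: A)) i j = limn (pseries (expcoef Q i j) x).
  by apply/esym/cvg_lim => //; exact: expm_pseries_cvgto.
have cv Q (x : R) : cvgn (pseries (expcoef Q i j) x).
  by apply/cvg_ex; eexists; exact: expm_pseries_cvgto.
rewrite E; under eq_fun do rewrite E.
rewrite -expcoef_diffs.
(* The series and its first two formal derivatives must converge at a point of modulus above |t|.
   All three have coefficients [expcoef], hence converge everywhere, and |t| + 1 is such a point. *)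
apply: (@pseries_snd_diffs _ _ (`|t| + 1)); rewrite ?expcoef_diffs//.
by rewrite (@ger0_norm _ (_ + 1)) ?addr_ge0// ltrDl.
Qed.

Lemma expm0 : expmR (0 *: A) = 1%:M.
Proof.
apply/matrixP => i j; rewrite expm_entry.
(* The empty partial sum is 0 and every later one is the entry of the identity, so the limit is read
   off after a shift by one. *)
have -> : pseries (expcoef 1%:M i j) (0 : R) =
    (fun p => if p is 0 then 0 else (1%:M : 'M[R]_n) i j).
  apply/funext => -[|p]; rewrite /pseries seriesEord /= ?big_ord0//.
  rewrite big_ord_recl big1 ?addr0 => [|k _]; last by rewrite /= expr0n mulr0.
  by rewrite /= /expcoef expr0 fact0 invr1 !mul1r mulr1 mulmx1.
apply/cvg_lim => //; rewrite -cvg_shiftS; exact: cvg_cst.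
Qed.

Lemma expm_tr (t : R) : expmR (t *: A^T) = (expmR (t *: A))^T.
Proof.
have trX (M : 'M[R]_n) k : M^T ^+ k = (M ^+ k)^T.
  elim: k => [|k IH]; first by rewrite !expr0 trmx1.
  by rewrite exprS exprSr IH -!mulmxE trmx_mul.
apply/matrixP => i j; rewrite !mxE; congr slim; apply/funext => p.
rewrite !summxE; apply: eq_bigr => k _.
by rewrite -linearZ trX !mxE.
Qed.

Lemma cmx_mulE (P : 'M[C]_n) (M : 'M[R]_n) i j :
  (P *m cmx M) i j = Complex ((map_mx Re P *m M) i j) ((map_mx Im P *m M) i j).
Proof.
apply/eqP; rewrite eq_complex !mxE complexRe_sum complexIm_sum /=.
apply/andP; split; apply/eqP; apply: eq_bigr => k _.
  by rewrite !mxE complexReM /= mulr0 subr0.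
by rewrite !mxE complexImM /= mulr0 add0r.
Qed.

(* If Q (A - z_1) ... (A - z_k) = 0 then u = Q exp(tA) solves u' = z_1 u + g where
   g = Q (A - z_1) exp(tA) decays by induction. *)
Lemma expm_decay_factor (s : seq C) (P : 'M[C]_n) : all (fun z => Re z < 0) s ->
  P *m \prod_(z <- s) (cmx A - z%:M) = 0 ->
  forall i j, edecay (fun t : R => Re ((P *m cmx (expmR (t *: A))) i j) ^+ 2 +
                               Im ((P *m cmx (expmR (t *: A))) i j) ^+ 2).
Proof.
elim: s P => [|z s IH] P /=.
  move=> _; rewrite big_nil mulmx1 => -> i j.
  under eq_fun do rewrite mul0mx mxE /= expr0n addr0.
  exact: edecay0.
move=> /andP[z0 s0]; rewrite big_cons -mulmxE mulmxA => /(IH _ s0) IHs i j.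
have derC (Q : 'M[C]_n) (t : R) :
    is_derive t 1 (fun t : R => Re ((Q *m cmx (expmR (t *: A))) i j))
      (Re ((Q *m cmx A *m cmx (expmR (t *: A))) i j)) /\
    is_derive t 1 (fun t : R => Im ((Q *m cmx (expmR (t *: A))) i j))
      (Im ((Q *m cmx A *m cmx (expmR (t *: A))) i j)).
  have QA : map_mx Re (Q *m cmx A) = map_mx Re Q *m A /\
            map_mx Im (Q *m cmx A) = map_mx Im Q *m A.
    by split; apply/matrixP => k l; rewrite mxE cmx_mulE.
  rewrite !cmx_mulE /= !QA.1 !QA.2; split.
    by under eq_fun do rewrite cmx_mulE /=; exact: expm_derive.
  by under eq_fun do rewrite cmx_mulE /=; exact: expm_derive.
have PA : P *m cmx A = z *: P + P *m (cmx A - z%:M).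
  by rewrite mulmxBr mul_mx_scalar addrC subrK.
apply: edecay_forced z0 _ _ (IHs i j) => t.
  apply: is_derive_eq; first exact: (derC P t).1.
  by rewrite PA mulmxDl -scalemxAl !mxE complexReD complexReM.
apply: is_derive_eq; first exact: (derC P t).2.
rewrite PA mulmxDl -scalemxAl !mxE complexImD complexImM.
by congr (_ + _); rewrite addrC.
Qed.

(** The characteristic polynomial splits over [C], and a root with nonnegative real part would be an
    eigenvalue that [hurwitz] excludes. Cayley-Hamilton then supplies the vanishing product for
    [expm_decay_factor], with [P] the identity. *)
Lemma expm_decay : hurwitz A -> forall i j, edecay (fun t : R => expmR (t *: A) i j ^+ 2).
Proof.
move=> hA i j.
have [s cpE] := closed_field_poly_normal (char_poly (cmx A)).
have cm := char_poly_monic (cmx A).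
rewrite (monicP cm) scale1r in cpE.
have s0 : all (fun z => Re z < 0) s.
  apply/allP => z zs; rewrite ltNge; apply/negP => /hA /eqP; apply.
  have : root (char_poly (cmx A)) z by rewrite cpE root_prod_XsubC.
  rewrite -eigenvalue_root_char => /eigenvalueP[v vA v0].
  apply/eqP; rewrite -[_ == 0]negbK; apply/negP => dt.
  have U : z%:M - cmx A \in unitmx by rewrite unitmxE unitfE.
  have : v *m (z%:M - cmx A) = 0 by rewrite mulmxBr vA mul_mx_scalar subrr.
  move=> /(congr1 (mulmx^~ (invmx (z%:M - cmx A)))).
  by rewrite mulmxK// mul0mx => v0'; rewrite v0' eqxx in v0.
have P0 : 1%:M *m \prod_(z <- s) (cmx A - z%:M) = 0.
  rewrite mul1mx -(Cayley_Hamilton (cmx A)) cpE rmorph_prod.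
  by apply: eq_bigr => z _; rewrite rmorphB /= horner_mx_X horner_mx_C.
have := expm_decay_factor s0 P0 i j.
have cmxE (t : R) : cmx (expmR (t *: A)) i j = (expmR (t *: A) i j)%:C%C by rewrite mxE.
by under eq_fun do rewrite mul1mx cmxE /= expr0n addr0.
Qed.

Lemma lyap_derive (U : 'M[R]_n) (t : R) i j :
  let Z (t : R) := expmR (t *: A) *m U *m expmR (t *: A^T) in
  is_derive t 1 (fun t : R => Z t i j) ((A *m Z t + Z t *m A^T) i j).
Proof.
move=> Z.
have ZE (x : R) : Z x i j =
    \sum_k \sum_l expmR (x *: A) i k * (U k l * expmR (x *: A) j l).
  rewrite /Z expm_tr -mulmxA mxE; apply: eq_bigr => k _.
  rewrite [X in _ * X]mxE mulr_sumr; apply: eq_bigr => l _.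
  by rewrite [X in _ * (_ * X)]mxE.
have dE a b : is_derive t 1 (fun t : R => expmR (t *: A) a b) ((A *m expmR (t *: A)) a b).
  by have := expm_derive 1%:M t a b; rewrite mul1mx; under eq_fun do rewrite mul1mx.
under eq_fun do rewrite ZE.
have d : is_derive t 1
    (fun x : R => \sum_k \sum_l expmR (x *: A) i k * (U k l * expmR (x *: A) j l))
    (\sum_k \sum_l ((A *m expmR (t *: A)) i k * (U k l * expmR (t *: A) j l) +
                    expmR (t *: A) i k * (U k l * (A *m expmR (t *: A)) j l))).
  apply: (@is_derive_sumf _ _ _ (fun k x =>
    \sum_l expmR (x *: A) i k * (U k l * expmR (x *: A) j l))) => k.
  apply: (@is_derive_sumf _ _ _ (fun l x =>
    expmR (x *: A) i k * (U k l * expmR (x *: A) j l))) => l.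
  exact: is_deriveMf (dE i k) (is_deriveZf (U k l) (dE j l)).
apply: (is_derive_eq d); rewrite {d}.
under eq_bigr do rewrite big_split.
rewrite big_split mxE /=; congr (_ + _).
  rewrite /Z expm_tr !mulmxA -(mulmxA (_ *m _)) mxE; apply: eq_bigr => k _.
  rewrite [X in _ = _ * X]mxE mulr_sumr; apply: eq_bigr => l _.
  by rewrite [X in _ = _ * (_ * X)]mxE.
rewrite /Z expm_tr -(mulmxA (expmR _ *m U)) -trmx_mul -mulmxA mxE; apply: eq_bigr => k _.
rewrite [X in _ = _ * X]mxE mulr_sumr; apply: eq_bigr => l _.
by rewrite [X in _ = _ * (_ * X)]mxE.
Qed.

Lemma lyap_decay (U : 'M[R]_n) i j : hurwitz A ->
  edecay (fun t : R => (expmR (t *: A) *m U *m expmR (t *: A^T)) i j).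
Proof.
move=> hA.
have ZE (x : R) : (expmR (x *: A) *m U *m expmR (x *: A^T)) i j =
    \sum_k \sum_l U k l * (expmR (x *: A) i k * expmR (x *: A) j l).
  rewrite expm_tr -mulmxA mxE; apply: eq_bigr => k _.
  rewrite [X in _ * X]mxE mulr_sumr; apply: eq_bigr => l _.
  by rewrite [X in _ * (_ * X)]mxE mulrCA.
under eq_fun do rewrite ZE.
apply: edecay_sum => k; apply: edecay_sum => l; apply: edecayZ.
by apply: edecay_mul; apply: expm_decay.
Qed.

End MatrixExponential.

(** * The Lyapunov integral *)

Section Lyapunov.
Variable R : realType.

Lemma LA_entry N (A U : 'M[R]_N) i j : LA A U i j =
  \int[lebesgue_measure]_(t in `[0, +oo[)
     (expmR (t *: A) *m U *m expmR (t *: A^T)) i j.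
Proof.
rewrite mxE; congr (Rintegral _ _ _); apply/seteqP.
by split => x /=; rewrite in_itv /= andbT.
Qed.

(** The integrand Z(t) = exp(tA) U exp(tA^T) decays and satisfies Z' = A Z + Z A^T, so integrating
    Z' over the half-line gives -Z(0) = -U. The rest exchanges the integral with the finite sums in
    the matrix products. *)
Lemma LA_lyapunov N (A U : 'M[R]_N) : hurwitz A ->
  A *m LA A U + LA A U *m A^T + U = 0.
Proof.
(* The exponential was studied in positive size; in size 0 there are no entries to compare. *)
case: N A U => [A U _|n A U hA]; first by apply/matrixP => -[].
pose Z (t : R) := expmR (t *: A) *m U *m expmR (t *: A^T).
have cZ i j : continuous (fun t : R => Z t i j).
  by apply: is_derive_continuous => t; exact: lyap_derive.
have dZ i j : edecay (fun t : R => Z t i j) by exact: lyap_decay.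
have iZ i j := edecay_integrable (cZ i j) (dZ i j).
pose D (t : R) := A *m Z t + Z t *m A^T.
have DE (t : R) i j : D t i j = \sum_k (A i k * Z t k j + A j k * Z t i k).
  rewrite mxE big_split; congr (_ + _); rewrite mxE; apply: eq_bigr => // k _.
  by rewrite !mxE mulrC.
have cM (a : R) i j : continuous (fun t : R => a * Z t i j).
  apply: (@is_derive_continuous _ _ (fun t => a * (A *m Z t + Z t *m A^T) i j)) => t.
  by apply: is_deriveZf; exact: lyap_derive.
have dM (a : R) i j : edecay (fun t : R => a * Z t i j) by exact/edecayZ.
have iM (a : R) i j := edecay_integrable (cM a i j) (dM a i j).
(* Continuity is proved together with the exchange because the induction step needs the tail sum to
   be integrable. *)
have RI (I : Type) (s : seq I) (f : I -> R -> R) :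
    (forall k, continuous (f k)) -> (forall k, edecay (f k)) ->
    \int[lebesgue_measure]_(t in `[0, +oo[) (\sum_(k <- s) f k t) =
    \sum_(k <- s) \int[lebesgue_measure]_(t in `[0, +oo[) f k t /\
    continuous (fun t : R => \sum_(k <- s) f k t).
  move=> cf df; elim: s => [|k s [IH cs]].
    have -> : (fun t : R => \sum_(k <- [::]) f k t) = cst 0.
      by apply/funext => t; rewrite big_nil.
    split; last exact: cst_continuous.
    by rewrite big_nil /Rintegral integral0.
  have -> : (fun t : R => \sum_(j <- k :: s) f j t) =
            (fun t : R => f k t + \sum_(j <- s) f j t).
    by apply/funext => t; rewrite big_cons.
  rewrite big_cons -IH; split.
    by rewrite RintegralD//; apply: edecay_integrable => //; exact: edecay_sum.
  by move=> t; apply: cvgD; [exact: cf|exact: cs].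
apply/matrixP => i j.
pose f k (t : R) := A i k * Z t k j + A j k * Z t i k.
have cf k : continuous (f k) by move=> t; apply: cvgD; exact: cM.
have df k : edecay (f k) by exact: edecayD.
have [I1 c1] := RI _ (index_enum _) f cf df.
have DI : (fun t : R => \sum_k f k t) = (fun t => D t i j).
  by apply/funext => t; rewrite DE.
have E1 : \int[lebesgue_measure]_(t in `[0, +oo[) D t i j = - U i j.
  have cD : continuous (fun t => D t i j) by rewrite -DI.
  have dD : edecay (fun t => D t i j) by rewrite -DI; exact: edecay_sum.
  rewrite (edecay_FTC cD dD (dZ i j) (fun t => lyap_derive A U t i j)).
  by rewrite /Z expm_tr expm0 trmx1 mul1mx mulmx1.
rewrite -DI I1 in E1.
have -> : (A *m LA A U + LA A U *m A^T + U) i j =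
    \sum_k (A i k * LA A U k j + A j k * LA A U i k) + U i j.
  rewrite mxE [X in X + _]mxE [X in X + _ + _]mxE [X in _ + X + _]mxE -big_split /=.
  congr (_ + _); apply: eq_bigr => k _; congr (_ + _).
  by rewrite [A^T _ _]mxE mulrC.
rewrite [RHS]mxE -(opprK (U i j)) -E1; apply/eqP; rewrite subr_eq0; apply/eqP.
by apply: eq_bigr => k _; rewrite /f RintegralD// !RintegralZl// -!LA_entry.
Qed.

Lemma LA_tr N (A U : 'M[R]_N) : (LA A U)^T = LA A U^T.
Proof.
case: N A U => [A U|n A U]; first by apply/matrixP => -[].
apply/matrixP => i j; rewrite mxE !LA_entry; apply: eq_Rintegral => t _.
have -> : expmR (t *: A) *m U^T *m expmR (t *: A^T) =
    (expmR (t *: A) *m U *m expmR (t *: A^T))^T.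
  by rewrite expm_tr !trmx_mul !trmxK mulmxA.
by rewrite [RHS]mxE.
Qed.

(** Linearity of the integral asks for an integrable integrand, which is where [hurwitz] enters. *)
Lemma LA_opp N (A U : 'M[R]_N) : hurwitz A -> LA A (- U) = - LA A U.
Proof.
case: N A U => [A U _|n A U hA]; first by apply/matrixP => -[].
apply/matrixP => i j; rewrite [RHS]mxE !LA_entry -[RHS]mulN1r -RintegralZl//.
  by apply: eq_Rintegral => t _; rewrite mulmxN mulNmx mxE mulN1r.
apply: edecay_integrable; last exact: lyap_decay.
by apply: is_derive_continuous => t; exact: lyap_derive.
Qed.

End Lyapunov.

(** * Adjoints, and the symmetry of J and S *)

Section Adjoint.
Variable R : realType.
Local Notation C := R[i].

Lemma cmxM m n p (M : 'M[R]_(m, n)) (M' : 'M[R]_(n, p)) : cmx (M *m M') = cmx M *m cmx M'.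
Proof. exact: (map_mxM (real_complex R)). Qed.
Lemma cmxD m n (M M' : 'M[R]_(m, n)) : cmx (M + M') = cmx M + cmx M'.
Proof. exact: (map_mxD (real_complex R)). Qed.
Lemma cmxN m n (M : 'M[R]_(m, n)) : cmx (- M) = - cmx M.
Proof. exact: (map_mxN (real_complex R)). Qed.
Lemma cmx1 n : cmx (1%:M : 'M[R]_n) = 1%:M.
Proof. exact: (map_mx1 (real_complex R)). Qed.

Lemma cadjM m n p (M : 'M[C]_(m, n)) (M' : 'M[C]_(n, p)) : adj (M *m M') = adj M' *m adj M.
Proof. by rewrite /adj map_mxM trmx_mul. Qed.
Lemma cadjD m n (M M' : 'M[C]_(m, n)) : adj (M + M') = adj M + adj M'.
Proof. by rewrite /adj map_mxD linearD. Qed.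
Lemma cadjN m n (M : 'M[C]_(m, n)) : adj (- M) = - adj M.
Proof. by rewrite /adj map_mxN linearN. Qed.
Lemma cadjZ m n (a : C) (M : 'M[C]_(m, n)) : adj (a *: M) = conjc a *: adj M.
Proof. by rewrite /adj map_mxZ linearZ. Qed.
Lemma cadjK m n (M : 'M[C]_(m, n)) : adj (adj M) = M.
Proof. by apply/matrixP => i j; rewrite !mxE conjcK. Qed.
Lemma cadj_cmx m n (M : 'M[R]_(m, n)) : adj (cmx M) = cmx M^T.
Proof. by apply/matrixP => i j; rewrite !mxE /= oppr0. Qed.
Lemma cadj_scalar n (a : C) : adj (a%:M : 'M[C]_n) = (conjc a)%:M.
Proof. by rewrite /adj map_scalar_mx tr_scalar_mx. Qed.

Lemma Jmx_tr m : (Jmx R m)^T = - Jmx R m.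
Proof.
apply/matrixP => i j; rewrite !mxE.
case: (boolP (j.+1 == i :> nat)) => [/eqP ji|ji]; case: (boolP (i.+1 == j :> nat)) => [/eqP ij|ij].
- by exfalso; move: ij; rewrite -ji; apply/eqP; rewrite neq_ltn ltnS leqnSn orbT.
- rewrite [i == _ :> nat]eq_sym [j == _ :> nat]eq_sym ji eqxx (negbTE ij).
  by rewrite -ji /= negbK !andbT andbF; case: (odd j); rewrite ?opprK ?oppr0.
- rewrite [i == _ :> nat]eq_sym [j == _ :> nat]eq_sym ij eqxx (negbTE ji).
  by rewrite -ij /= negbK !andbT andbF; case: (odd i); rewrite ?opprK ?oppr0.
- by rewrite [i == _ :> nat]eq_sym [j == _ :> nat]eq_sym (negbTE ij) (negbTE ji) !andbF oppr0.
Qed.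

(** J is real and antisymmetric, so iJ is Hermitian. Hence the left factor S of [Sigma] is the
    adjoint of the right one, and [Sigma] can be read as a sesquilinear form in F S w. *)
Lemma cadj_Smx m : adj (Smx R m) = Smx R m.
Proof.
rewrite /Smx cadjZ conjc_real; congr (_ *: _).
rewrite /Omega linearD linearZ /= trmx1 cadjD cadj_scalar rmorph1 cadjZ.
have -> : (cmx (Jmx R m))^T = - cmx (Jmx R m).
  by rewrite -cmxN -Jmx_tr /cmx map_trmx.
rewrite cadjN cadj_cmx Jmx_tr cmxN opprK scalerN -scaleNr; congr (_ + _ *: _).
by apply/eqP; rewrite eq_complex /= oppr0 !eqxx.
Qed.

End Adjoint.

(** * Parities and Lyapunov equations in the recursion *)

Section Recursion.
Variables (R : realType) (N m r : nat) (A Theta : 'M[R]_N) (Bc : 'M[R]_(N, m))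
  (Cc : 'M[R]_(r, N)).
Local Notation al := (alpha A Theta Bc Cc).
Local Notation be := (beta A Theta Bc Cc).
Local Notation ga := (gamma A Theta Bc Cc).

Definition Pfac (k : nat) : 'M[R]_N := if k == 0%N then Pimx Cc else 1%:M.
(** The source term of the Lyapunov equation of [ga k.+1], and at the same time the middle factor of
    [be k.+2]. *)
Definition forcing (k : nat) : 'M[R]_N := al k.+1 *m Pfac k *m ga k.

Lemma alphaE k : al k.+1 = ga k *m be k.
Proof.
case: k => [|k]; first by rewrite /alpha /gamma /beta /= mulmx1.
by rewrite /alpha /gamma /beta /=; case: (abg _ _ _ _ k) => [[a b] g].
Qed.

Lemma gammaSE k : ga k.+1 = LA A (forcing k).
Proof. by rewrite /forcing /alpha /gamma /=; case: (abg _ _ _ _ k) => [[a b] g]. Qed.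

Lemma betaSE k : be k.+2 = invmx (ga k.+1) *m forcing k *m invmx (ga k.+1).
Proof.
rewrite /forcing /alpha /gamma /beta /=; case: (abg _ _ _ _ k) => [[a b] g] /=.
by rewrite !mulmxA.
Qed.

Lemma subdE k : subd A Theta Bc Cc k.+1 = al k.+1 *m Pfac k.
Proof. by case: k => [|k]; rewrite /subd /Pfac //= mulmx1. Qed.

Hypotheses (Theta_tr : Theta^T = - Theta) (Theta_unit : Theta \in unitmx)
  (A_hurwitz : hurwitz A)
  (ga_unit : forall k, (0 < k)%N -> \det (ga k) != 0).

Lemma gamma_unit k : ga k \in unitmx.
Proof. by case: k => [//|k]; rewrite unitmxE unitfE ga_unit. Qed.

Lemma LA_sign (U : 'M[R]_N) k : LA A ((-1) ^+ k *: U) = (-1) ^+ k *: LA A U.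
Proof.
elim: k => [|k IH]; first by rewrite expr0 !scale1r.
by rewrite exprS mulN1r !scaleNr LA_opp// IH.
Qed.

Lemma invmx_sign_tr (M : 'M[R]_N) k : M \in unitmx -> M^T = (-1) ^+ k *: M ->
  (invmx M)^T = (-1) ^+ k *: invmx M.
Proof.
by move=> uM Mt; rewrite trmx_inv Mt invmxZ ?invr_sign// -Mt unitmx_tr.
Qed.

Lemma Mho_tr : (Mho Bc)^T = - Mho Bc.
Proof. by rewrite /Mho !trmx_mul trmxK Jmx_tr mulNmx mulmxN mulmxA. Qed.

(** The induction carries beta at two consecutive indices because [be k.+2] comes from [forcing k],
    hence from [be k]. Written as gamma_k (beta_k Pfac) gamma_k, the source inherits the sign of
    beta_k, the two signs of gamma_k cancelling; [LA] and conjugation by an inverse then pass it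
    on. *)
Lemma recursion_parity k :
  [/\ (ga k)^T = (-1) ^+ k.+1 *: ga k, (be k)^T = (-1) ^+ k *: be k
    & (be k.+1)^T = (-1) ^+ k.+1 *: be k.+1].
Proof.
elim: k => [|k [gk bk bk1]].
  have T1 : Theta^T = (-1) ^+ 1 *: Theta by rewrite expr1 scaleN1r.
  split; first exact: T1.
    by rewrite /= trmx1 expr0 scale1r.
  rewrite /beta /= trmx_mul (trmx_mul (invmx Theta) (Mho Bc)) (invmx_sign_tr Theta_unit T1) Mho_tr.
  by rewrite !expr1 !scaleN1r !(mulNmx, mulmxN) opprK mulmxA.
have fk : (forcing k)^T = (-1) ^+ k *: forcing k.
  (* The factor Pi occurs only at k = 0, where beta is the identity and the product is the symmetric
     matrix Pi. *)
  have bPk : (be k *m Pfac k)^T = (-1) ^+ k *: (be k *m Pfac k).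
    case: (k) bk => [|l] bl.
      by rewrite /Pfac /beta /= mul1mx expr0 scale1r /Pimx trmx_mul trmxK.
    by rewrite /Pfac /= mulmx1 bl.
  rewrite /forcing alphaE -(mulmxA (ga k)) trmx_mul (trmx_mul (ga k)) bPk gk.
  rewrite -!scalemxAl -!scalemxAr ?scalerA !mulmxA.
  congr (_ *: _); rewrite exprS mulN1r mulrN !mulNr opprK.
  by rewrite -mulrA -expr2 sqrr_sign mulr1.
have gk1 : (ga k.+1)^T = (-1) ^+ k *: ga k.+1 by rewrite gammaSE LA_tr fk LA_sign.
split => //; first by rewrite gk1 !exprS mulrA mulN1r opprK mul1r.
rewrite betaSE trmx_mul (trmx_mul (invmx _) (forcing k)) fk (invmx_sign_tr (gamma_unit _) gk1).
rewrite -!scalemxAl -!scalemxAr ?scalerA !mulmxA.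
congr (_ *: _); rewrite !exprS !mulN1r opprK.
by rewrite -mulrA -expr2 sqrr_sign mulr1.
Qed.

(** Beta and gamma of the same index have opposite parities, so transposing their product always
    yields one minus sign. It is the source of the alternating sign in [cascade_form]. *)
Lemma alphaS_tr k : (al k.+2)^T = - (be k.+1 *m ga k.+1).
Proof.
have [_ _ bk1] := recursion_parity k; have [gk1 _ _] := recursion_parity k.+1.
rewrite alphaE trmx_mul bk1 gk1 -scalemxAl -scalemxAr scalerA.
by rewrite !exprS !mulN1r opprK mulNr -expr2 sqrr_sign scaleN1r.
Qed.

Lemma gamma_lyapunov k : A *m ga k.+1 + ga k.+1 *m A^T + forcing k = 0.
Proof. by rewrite gammaSE LA_lyapunov. Qed.

End Recursion.

Lemma expmxZ (F : comNzRingType) n (a : F) (M : 'M[F]_n) k : (a *: M) ^+ k = a ^+ k *: M ^+ k.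
Proof.
elim: k => [|k IH]; first by rewrite !expr0 scale1r.
by rewrite !exprS IH -!mulmxE -scalemxAl -scalemxAr scalerA.
Qed.

(** * The resolvent on the imaginary axis *)

Section Resolvent.
Variables (R : realType) (N : nat) (A : 'M[R]_N) (lam : R).
Hypothesis A_hurwitz : hurwitz A.
Local Notation g := (Gs A (ilam lam)).
Local Notation E := ((ilam lam)%:M - cmx A).

Lemma resolvent_unit : E \in unitmx.
Proof. by rewrite unitmxE unitfE; apply: A_hurwitz; rewrite /= lexx. Qed.

Lemma conj_ilam : conjc (ilam lam) = - ilam lam.
Proof. by apply/eqP; rewrite eq_complex /= oppr0 !eqxx. Qed.

(** For s on the imaginary axis s X and X conj(s) cancel, so the Lyapunov equation can be rewritten
    through [E] alone. *)
Lemma resolvent_lyapunov (X U : 'M[R]_N) : A *m X + X *m A^T + U = 0 ->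
  cmx U = E *m cmx X + cmx X *m adj E.
Proof.
move=> /eqP; rewrite addrC addr_eq0 => /eqP ->.
rewrite cmxN cmxD !cmxM cadjD cadjN cadj_cmx cadj_scalar conj_ilam.
rewrite mulmxBl mulmxBr mul_scalar_mx mul_mx_scalar scaleNr.
by rewrite addrACA subrr add0r opprD.
Qed.

Lemma adj_resolventM : adj g *m adj E = 1%:M.
Proof. by rewrite -cadjM mulmxV ?resolvent_unit// cadj_scalar rmorph1. Qed.

Lemma adj_resolventV : adj E *m adj g = 1%:M.
Proof. by rewrite -cadjM mulVmx ?resolvent_unit// cadj_scalar rmorph1. Qed.

(* Both sides equal g^* X^-1 + X^-1 g. *)
Lemma resolvent_swap (X U : 'M[R]_N) : X \in unitmx -> A *m X + X *m A^T + U = 0 ->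
  adj g *m cmx (invmx X *m U *m invmx X) *m g =
  cmx (invmx X) *m (g *m cmx U *m adj g) *m cmx (invmx X).
Proof.
move=> uX /resolvent_lyapunov UE.
have XV : cmx X *m cmx (invmx X) = 1%:M by rewrite -cmxM mulmxV// cmx1.
have VX : cmx (invmx X) *m cmx X = 1%:M by rewrite -cmxM mulVmx// cmx1.
have gE : g *m E = 1%:M by rewrite mulVmx ?resolvent_unit.
have Eg : E *m g = 1%:M by rewrite mulmxV ?resolvent_unit.
transitivity (adj g *m cmx (invmx X) + cmx (invmx X) *m g).
  rewrite !cmxM UE mulmxDr mulmxDl !mulmxA -(mulmxA _ (cmx X)) XV VX mul1mx mulmx1.
  rewrite mulmxDr mulmxDl !mulmxA -(mulmxA _ E) Eg mulmx1.
  by rewrite adj_resolventM mul1mx.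
rewrite UE mulmxDr mulmxDl !mulmxA gE mul1mx -(mulmxA _ (adj E)) adj_resolventV mulmx1.
rewrite mulmxDr mulmxDl !mulmxA VX mul1mx -(mulmxA _ (cmx X)) XV mulmx1.
by [].
Qed.

End Resolvent.

(** * The cascade of transfer functions and the powers of Psi *)

Section Cascade.
Variables (R : realType) (N m r : nat) (A Theta : 'M[R]_N) (Bc : 'M[R]_(N, m))
  (Cc : 'M[R]_(r, N)) (lam : R).
Local Notation C := R[i].
Local Notation al := (alpha A Theta Bc Cc).
Local Notation be := (beta A Theta Bc Cc).
Local Notation ga := (gamma A Theta Bc Cc).
Local Notation U := (forcing A Theta Bc Cc).
Local Notation s := (ilam lam).
Local Notation g := (Gs A s).
Local Notation Psi := (Psi A Bc Cc lam).
Hypotheses (Theta_tr : Theta^T = - Theta) (Theta_unit : Theta \in unitmx)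
  (A_hurwitz : hurwitz A) (Theta_lyap : A *m Theta + Theta *m A^T + Mho Bc = 0)
  (ga_unit : forall k, (0 < k)%N -> \det (ga k) != 0).

(* cascade k is the transfer function G_(k+1) of the paper. *)
Fixpoint cascade (k : nat) : 'M[C]_(N, r) :=
  if k is k'.+1 then g *m cmx (al k.+1) *m cascade k' else g *m cmx Theta *m cmx Cc^T.

Lemma PsiE : Psi = cmx Cc *m (g *m cmx (Mho Bc) *m adj g) *m cmx Cc^T.
Proof. by rewrite /Defs.Psi /Fs !cadjM !cadj_cmx /Mho !cmxM !mulmxA. Qed.

(** [resolvent_swap] for the Lyapunov equation of [Theta]; [cascadeS_swap] does the same for
    [ga k.+1]. Each trades g U g^* for a form g^* beta g, whose beta is the next weight. *)
Lemma cascade0_swap :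
  cmx Theta *m (adj g *m cmx (be 1) *m g) *m cmx Theta = g *m cmx (Mho Bc) *m adj g.
Proof.
rewrite (_ : be 1 = invmx Theta *m Mho Bc *m invmx Theta)//.
rewrite resolvent_swap// !mulmxA -cmxM mulmxV// cmx1 mul1mx.
by rewrite -!mulmxA -cmxM mulVmx// cmx1 mulmx1.
Qed.

Lemma cascadeS_swap k :
  cmx (ga k.+1) *m (adj g *m cmx (be k.+2) *m g) *m cmx (ga k.+1) = g *m cmx (U k) *m adj g.
Proof.
have gu := gamma_unit Theta_unit ga_unit k.+1.
rewrite betaSE resolvent_swap//; last exact: gamma_lyapunov.
rewrite !mulmxA -cmxM mulmxV// cmx1 mul1mx.
by rewrite -!mulmxA -cmxM mulVmx// cmx1 mulmx1.
Qed.

(** Moves a factor Psi from the right of the cascade to its left. In the induction step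
    [cascadeS_swap] rewrites the left factor given by the hypothesis at k, and gamma_(k+1)
    beta_(k+1) regroups into alpha_(k+2), which restores the next stage of the cascade. *)
Lemma cascade_intertwine k :
  g *m cmx (U k) *m adj g *m cmx (be k.+1) *m cascade k = cascade k *m Psi.
Proof.
elim: k => [|k IH].
  rewrite PsiE -cascade0_swap /cascade.
  have -> : U 0 = Theta *m (Cc^T *m Cc) *m Theta by [].
  by rewrite !cmxM !mulmxA.
have -> : U k.+1 = al k.+2 *m ga k.+1 by rewrite /forcing /Pfac /= mulmx1.
rewrite [cascade k.+1]/= -/(cascade k).
have -> : g *m cmx (al k.+2) *m cascade k *m Psi =
    g *m cmx (al k.+2) *m (cmx (ga k.+1) *m (adj g *m cmx (be k.+2) *m g) *m cmx (ga k.+1)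
      *m cmx (be k.+1) *m cascade k).
  by rewrite cascadeS_swap IH !mulmxA.
by rewrite {2}alphaE !cmxM !mulmxA.
Qed.

(** Multiply the previous identity by Psi on the right, pull Psi through the cascade, and swap. The
    middle becomes beta gamma (g^* beta g) gamma beta, whose outer factors are alpha and, by
    [alphaS_tr], minus its transpose: this gives the next form with one more sign. *)
Lemma cascade_form k :
  (-1) ^+ k.+1 *: (adj (cascade k) *m cmx (be k.+1) *m cascade k) = Psi ^+ k.+1.
Proof.
elim: k => [|k IH].
  rewrite !expr1 scaleN1r PsiE -cascade0_swap /cascade !cadjM !cadj_cmx trmxK Theta_tr cmxN.
  by rewrite !(mulNmx, mulmxN) opprK !mulmxA.
rewrite [in RHS]exprSr -mulmxE -IH [cascade k.+1]/= -/(cascade k) -scalemxAl.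
rewrite -(mulmxA _ (cascade k)) -cascade_intertwine -cascadeS_swap.
rewrite !cadjM cadj_cmx alphaS_tr// alphaE cmxN !cmxM.
by rewrite [(-1) ^+ k.+2]exprS mulN1r scaleNr -scalerN !(mulNmx, mulmxN) opprK !mulmxA.
Qed.

(** The system is block lower bidiagonal, so it is solved forward from block 0, inverting s - A at
    each step. *)
Lemma cascade_state (y : Xs R N) (w : 'cV[C]_m) :
  (forall k, s *: y k - Aop A Theta Bc Cc y k = Bop Bc w k) ->
  y 0%N = g *m (cmx Bc *m Smx R m *m w) /\
  forall k, y k.+1 = cascade k *m (Fs A Bc Cc s *m Smx R m *m w).
Proof.
move=> yE; have sU := resolvent_unit lam A_hurwitz.
have y0 : y 0%N = g *m (cmx Bc *m Smx R m *m w).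
  have := yE 0%N; rewrite /Aop /Bop /= addr0 -mul_scalar_mx -mulmxBl => <-.
  by rewrite mulKmx.
have yS k : y k.+1 = g *m cmx (subd A Theta Bc Cc k.+1) *m y k.
  have := yE k.+1; rewrite /Aop /Bop /= opprD addrA -mul_scalar_mx -mulmxBl.
  by move=> /eqP; rewrite subr_eq0 -mulmxA => /eqP <-; rewrite mulKmx.
split => //; elim=> [|k IH]; last by rewrite yS IH subdE /Pfac /= mulmx1 !mulmxA.
rewrite yS y0 /= subdE /Pfac /= /Pimx /Fs.
by rewrite (_ : al 1 = Theta)// !cmxM !mulmxA.
Qed.

(** The minus sign in the weights [Hblk] absorbs the sign of [cascade_form], so block k contributes
    exactly the k-th term of phi(2 i theta Psi), block 0 giving the constant term. The match is
    exact at each finite stage. *)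
Lemma output_partial_sum (theta : R) (y1 y2 : Xs R N) (w1 w2 : 'cV[C]_m) p :
  (forall k, s *: y1 k - Aop A Theta Bc Cc y1 k = Bop Bc w1 k) ->
  (forall k, s *: y2 k - Aop A Theta Bc Cc y2 k = Bop Bc w2 k) ->
  \sum_(k < p.+1) adj (y1 k) *m CTop Cc (Hop A Theta Bc Cc theta (Cop Cc y2)) k =
  adj (Fs A Bc Cc s *m Smx R m *m w1) *m
  (\sum_(k < p.+1) ((k.+1)`!%:R)^-1 *: ((((2 * theta)%:C)%C * Complex 0 1) *: Psi) ^+ k) *m
  (Fs A Bc Cc s *m Smx R m *m w2).
Proof.
move=> /cascade_state[y10 y1S] /cascade_state[y20 y2S].
rewrite !big_ord_recl /= mulmxDr mulmxDl; congr (_ + _).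
  rewrite y10 y20 invr1 scale1r expr0 mulmx1 -(trmxK Cc) -cadj_cmx trmxK !mulmxA -cadjM.
  by rewrite /Fs !mulmxA.
rewrite mulmx_sumr mulmx_suml; apply: eq_bigr => k _.
rewrite /bump /= add1n y1S y2S /Hblk.
rewrite expmxZ -cascade_form cadjM.
rewrite -!scalemxAl -!scalemxAr -!scalemxAl !scalerA !mulmxA; congr (_ *: _).
by rewrite mulNr exprNn; ring.
Qed.

End Cascade.

(** * Pairing the Riccati equation with states of the system *)

Section ClosedLoop.
Variables (R : realType) (N m r : nat) (A Theta : 'M[R]_N) (Bc : 'M[R]_(N, m))
  (Cc : 'M[R]_(r, N)).
Local Notation C := R[i].
Local Notation Aop := (Aop A Theta Bc Cc).
Local Notation ATop := (ATop A Theta Bc Cc).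
Local Notation subd := (subd A Theta Bc Cc).

(** Summation by parts: truncation after block p keeps the coupling from block p to block p + 1 in
    the transpose but cuts it in [Aop], which leaves one boundary term. *)
Lemma Aop_adjoint_partial (x y : Xs R N) p :
  \sum_(k < p.+1) (adj (x k) *m ATop y k) 0 0 =
  \sum_(k < p.+1) (adj (Aop x k) *m y k) 0 0
  + (adj (cmx (subd p.+1) *m x p) *m y p.+1) 0 0.
Proof.
have ATE k : adj (x k) *m ATop y k =
    adj (cmx A *m x k) *m y k + adj (cmx (subd k.+1) *m x k) *m y k.+1.
  by rewrite /Defs.ATop mulmxDr !cadjM !cadj_cmx !mulmxA.
elim: p => [|p IH].
  by rewrite !big_ord1 ATE /Defs.Aop addr0 mxE.
rewrite big_ord_recr IH [X in _ = X + _]big_ord_recr /= ATE.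
rewrite {3}/Defs.Aop cadjD mulmxDl [X in _ + X = _]mxE [X in _ = _ + X + _]mxE.
by rewrite -!addrA; congr (_ + _); rewrite addrCA.
Qed.

(** The boundary term vanishes in the limit because its left entry is (Ax)_(p+1) minus the diagonal
    part, a difference of square-summable sequences. *)
Lemma Aop_adjoint_cvg (x y : Xs R N) : bddXX Aop -> l2 x -> l2 y ->
  ccvg (fun p => \sum_(k < p) (adj (x k) *m ATop y k) 0 0) (ip (Aop x) y).
Proof.
move=> bA x2 y2; have Ax2 := bddXX_l2 bA x2.
apply: ccvgS; under eq_fun do rewrite Aop_adjoint_partial.
rewrite -[ip _ _]addr0; apply: ccvgD.
  exact: ccvg_succ (ip_cvg Ax2 y2).
apply: (@inner_cvg0 _ _ (fun p => cmx (subd p.+1) *m x p) (fun p => y p.+1)); last exact: l2S.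
have -> : (fun p => cmx (subd p.+1) *m x p) = (fun p => Aop x p.+1 + - (cmx A *m x p.+1)).
  by apply/funext => p; rewrite /Defs.Aop addrAC subrr add0r.
by apply: l2D; [exact: (l2S Ax2)|apply: l2N; exact: (l2S (l2_mulmx _ x2))].
Qed.

Section State.
Variables (lam : R) (x : Xs R N) (w : 'cV[C]_m).
Hypotheses (x2 : l2 x)
  (xE : forall k, ilam lam *: x k - Aop x k = Bop Bc w k).

Lemma state_Aop k : Aop x k = ilam lam *: x k - Bop Bc w k.
Proof. by rewrite -xE opprB addrCA subrr addr0. Qed.

(** In the first slot i lam is conjugated to -i lam, in the second it is kept; this opposition makes
    the two terms cancel in [riccati_pairing]. *)
Lemma ip_state_l (z : Xs R N) : l2 z ->
  ip (Aop x) z = - ilam lam * ip x z - (adj w *m Bstar Bc z) 0 0.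
Proof.
move=> z2; apply: ip_eq; apply: ccvgS.
have -> : (fun p => \sum_(k < p.+1) (adj (Aop x k) *m z k) 0 0) =
  (fun p => - ilam lam * (\sum_(k < p.+1) (adj (x k) *m z k) 0 0) - (adj w *m Bstar Bc z) 0 0).
  apply/funext => p.
  have E k : (adj (Aop x k) *m z k) 0 0 =
      - ilam lam * (adj (x k) *m z k) 0 0 - (adj (Bop Bc w k) *m z k) 0 0.
    by rewrite state_Aop cadjD cadjN cadjZ conj_ilam mulmxDl mulNmx -scalemxAl !mxE.
  under eq_bigr do rewrite E.
  rewrite sumrB -mulr_sumr; congr (_ - _).
  rewrite big_ord_recl big1 ?addr0 => [|k _]; first by rewrite /Bop /Bstar /= cadjM mulmxA.
  by rewrite /Bop /= /adj map_mx0 trmx0 mul0mx mxE.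
apply: ccvgD; last exact: ccvg_cst.
exact: ccvgM (ccvg_cst _) (ccvg_succ (ip_cvg x2 z2)).
Qed.

Lemma ip_state_r (z : Xs R N) : l2 z ->
  ip z (Aop x) = ilam lam * ip z x - (adj (Bstar Bc z) *m w) 0 0.
Proof.
move=> z2; apply: ip_eq; apply: ccvgS.
have -> : (fun p => \sum_(k < p.+1) (adj (z k) *m Aop x k) 0 0) =
  (fun p => ilam lam * (\sum_(k < p.+1) (adj (z k) *m x k) 0 0) - (adj (Bstar Bc z) *m w) 0 0).
  apply/funext => p.
  have E k : (adj (z k) *m Aop x k) 0 0 =
      ilam lam * (adj (z k) *m x k) 0 0 - (adj (z k) *m Bop Bc w k) 0 0.
    by rewrite state_Aop mulmxBr -scalemxAr !mxE.
  under eq_bigr do rewrite E.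
  rewrite sumrB -mulr_sumr; congr (_ - _).
  rewrite big_ord_recl big1 ?addr0 => [|k _]; last by rewrite /Bop /= mulmx0 mxE.
  by rewrite /Bop /Bstar /= cadjM cadjK !mulmxA.
apply: ccvgD; last exact: ccvg_cst.
exact: ccvgM (ccvg_cst _) (ccvg_succ (ip_cvg z2 x2)).
Qed.

End State.

Hypotheses (Theta_tr : Theta^T = - Theta) (Theta_unit : Theta \in unitmx)
  (A_hurwitz : hurwitz A) (Theta_lyap : A *m Theta + Theta *m A^T + Mho Bc = 0)
  (ga_unit : forall k, (0 < k)%N -> \det (gamma A Theta Bc Cc k) != 0).

Lemma output_cvg (lam theta : R) (y1 y2 : Xs R N) (w1 w2 : 'cV[C]_m) :
  (forall k, ilam lam *: y1 k - Aop y1 k = Bop Bc w1 k) ->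
  (forall k, ilam lam *: y2 k - Aop y2 k = Bop Bc w2 k) ->
  ccvg (fun p => \sum_(k < p)
      (adj (y1 k) *m CTop Cc (Hop A Theta Bc Cc theta (Cop Cc y2)) k) 0 0)
    ((adj w1 *m Sigma A Bc Cc theta lam *m w2) 0 0).
Proof.
move=> y1E y2E; apply: ccvgS.
under eq_fun => p do rewrite -summxE (output_partial_sum _ _ _ _ _ _ _ y1E y2E)//.
have -> : adj w1 *m Sigma A Bc Cc theta lam *m w2 =
    adj (Fs A Bc Cc (ilam lam) *m Smx R m *m w1) *m
    phimx ((((2 * theta)%:C)%C * Complex 0 1) *: Psi A Bc Cc lam) *m
    (Fs A Bc Cc (ilam lam) *m Smx R m *m w2).
  by rewrite /Sigma !cadjM cadj_Smx !mulmxA.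
set M := (_ *: Psi A Bc Cc lam).
have := mcvgM (mcvgM (mcvg_cst (adj (Fs A Bc Cc (ilam lam) *m Smx R m *m w1)))
  (phi_partial_cvg M)) (mcvg_cst (Fs A Bc Cc (ilam lam) *m Smx R m *m w2)).
by move=> /(_ 0 0) /ccvg_succ.
Qed.

Variables (theta : R) (Q : Xs R N -> Xs R N) (Lst : 'cV[C]_m -> Xs R N).
Hypotheses (A_bdd : bddXX Aop) (Q_bdd : bddXX Q)
  (Q_sym : forall x y, l2 x -> l2 y -> ip (Q x) y = ip x (Q y))
  (Lst_l2 : forall v, l2 (Lst v))
  (Lst_adj : forall x v, l2 x -> (adj (Bstar Bc (Q x)) *m v) 0 0 = ip x (Lst v))
  (riccati : forall x, l2 x ->
        (fun k => ATop (Q x) k + Q (Aop x) k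
                  + (theta%:C)%C *: CTop Cc (Hop A Theta Bc Cc theta (Cop Cc x)) k
                  + Lst (Bstar Bc (Q x)) k) = (fun _ => 0)).

Lemma riccati_pairing (lam : R) (y1 y2 : Xs R N) (w1 w2 : 'cV[C]_m) :
  l2 y1 -> l2 y2 ->
  (forall k, ilam lam *: y1 k - Aop y1 k = Bop Bc w1 k) ->
  (forall k, ilam lam *: y2 k - Aop y2 k = Bop Bc w2 k) ->
  (adj w1 *m Delta A Bc Cc theta lam *m w2) 0 0 =
  (adj (w1 - Bstar Bc (Q y1)) *m (w2 - Bstar Bc (Q y2))) 0 0.
Proof.
move=> y12 y22 y1E y2E.
have Qy1 := bddXX_l2 Q_bdd y12; have Qy2 := bddXX_l2 Q_bdd y22.
have Ay2 := bddXX_l2 A_bdd y22; have QAy2 := bddXX_l2 Q_bdd Ay2.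
have c1 := Aop_adjoint_cvg A_bdd y12 Qy2.
have c2 := ip_cvg y12 QAy2.
have c3 := ccvgM (ccvg_cst (theta%:C)%C) (output_cvg theta y1E y2E).
have c4 := ip_cvg y12 (Lst_l2 (Bstar Bc (Q y2))).
have c0 := ccvgD (ccvgD (ccvgD c1 c2) c3) c4.
(* The four limits are computed separately, while the sum of the four sequences is identically 0 by
   the Riccati equation at [y2]. *)
have H : ip (Aop y1) (Q y2) + ip y1 (Q (Aop y2))
    + (theta%:C)%C * (adj w1 *m Sigma A Bc Cc theta lam *m w2) 0 0
    + ip y1 (Lst (Bstar Bc (Q y2))) = 0.
  apply: (ccvg_unique c0); rewrite [X in ccvg X](_ : _ = fun=> 0); first exact: ccvg_cst.
  apply/funext => p; rewrite mulr_sumr -!big_split /= big1// => k _.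
  have := congr1 (fun f : Xs R N => (adj (y1 k) *m f k) 0 0) (riccati y22).
  by rewrite /= mulmx0 !mulmxDr -scalemxAr !mxE.
move: H; rewrite -Lst_adj// -(Q_sym y12 Ay2) (ip_state_l y12 y1E)//.
rewrite (ip_state_r y22 y2E)// (Q_sym y12 y22).
have -> : (adj w1 *m Delta A Bc Cc theta lam *m w2) 0 0 =
    (adj w1 *m w2) 0 0 - (theta%:C)%C * (adj w1 *m Sigma A Bc Cc theta lam *m w2) 0 0.
  rewrite /Delta mulmxBr mulmx1 mulmxBl -scalemxAr -scalemxAl.
  by rewrite [LHS]mxE; congr (_ + _); rewrite [LHS]mxE; congr (- _); rewrite [LHS]mxE.
have sesq (a b c d : 'cV[C]_m) : (adj (a - b) *m (c - d)) 0 0 =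
    (adj a *m c) 0 0 - (adj a *m d) 0 0 - (adj b *m c) 0 0 + (adj b *m d) 0 0.
  have entryB (X Y : 'M[C]_1) : (X - Y) 0 0 = X 0 0 - Y 0 0 by rewrite !mxE.
  by rewrite cadjD cadjN mulmxBl !mulmxBr !entryB; ring.
(* The i lam terms cancel, and what remains of [H] is the cross and quadratic part of the completed
   square. *)
rewrite sesq => H; apply/eqP; rewrite -subr_eq0 -oppr_eq0 -H; apply/eqP; ring.
Qed.

End ClosedLoop.

(** * The factorization of the inverse of Delta *)

Theorem theorem7p7 (R : realType) (N m r : nat)
  (A Theta : 'M[R]_N) (Bc : 'M[R]_(N, m)) (Cc : 'M[R]_(r, N)) (theta : R)
  (Q : Xs R N -> Xs R N) :
  ~~ odd m -> ~~ odd N ->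
  Theta^T = - Theta -> Theta \in unitmx ->
  hurwitz A ->
  A *m Theta + Theta *m A^T + Mho Bc = 0 ->
  0 < theta ->
  (forall k, (0 < k)%N -> \det (gamma A Theta Bc Cc k) != 0) ->
  (* the block operators are bounded *)
  bddXX (Aop A Theta Bc Cc) ->
  bddmX (Bop Bc) ->
  bddXY (Cop Cc) ->
  bddYY (Hop A Theta Bc Cc theta) ->
  (* sI - A boundedly invertible for Re s >= 0 *)
  (forall s : R[i], 0 <= @complex.Re R s ->
     binv (fun x k => s *: x k - Aop A Theta Bc Cc x k)) ->
  (* Q bounded self-adjoint *)
  linXX Q -> bddXX Q ->
  (forall x y, l2 x -> l2 y -> ip (Q x) y = ip x (Q y)) ->
  (* Riccati equation with L := B^* Q and L^* its adjoint *)
  (exists Lst : 'cV[R[i]]_m -> Xs R N,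
     (forall v, l2 (Lst v)) /\
     (forall x v, l2 x ->
        (adj (Bstar Bc (Q x)) *m v) 0 0 = ip x (Lst v)) /\
     (forall x, l2 x ->
        (fun k => ATop A Theta Bc Cc (Q x) k + Q (Aop A Theta Bc Cc x) k
                  + (theta%:C)%C *: CTop Cc (Hop A Theta Bc Cc theta (Cop Cc x)) k
                  + Lst (Bstar Bc (Q x)) k) = (fun _ => 0))) ->
  (* stabilizing: spectrum of A + B L in the open left half-plane *)
  (forall s : R[i], 0 <= @complex.Re R s ->
     binv (fun x k => s *: x k
                      - (Aop A Theta Bc Cc x k + Bop Bc (Bstar Bc (Q x)) k))) ->
  forall (lam : R) (Rinv : Xs R N -> Xs R N),
    is_binv (fun x k => ilam lam *: x k
                        - (Aop A Theta Bc Cc x k + Bop Bc (Bstar Bc (Q x)) k)) Rinv ->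
    let G := Gtf Bc (fun x => Bstar Bc (Q x)) Rinv in
    [/\ G \in unitmx,
        Delta A Bc Cc theta lam \in unitmx
      & invmx (Delta A Bc Cc theta lam) = G *m adj G].
Proof.
move=> _ _ Theta_tr Theta_unit A_hurwitz Theta_lyap _ ga_unit A_bdd _ _ _ _ _ Q_bdd Q_sym.
move=> [Lst [Lst_l2 [Lst_adj riccati]]] _ lam Rinv [_ Rinv_bdd _ RinvK] G.
have Be_l2 v : l2 (Bop Bc v : Xs R N).
  exists (sqn (cmx Bc *m Smx R m *m v)) => -[|p]; first by rewrite big_ord0 sqn_ge0.
  rewrite big_ord_recl big1 ?addr0// => k _; rewrite /sqn big1// => i _.
  by rewrite mxE /= expr0n addr0.
pose y j := Rinv (Bop Bc (delta_mx j 0)).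
have y_l2 j : l2 (y j) := bddXX_l2 Rinv_bdd (Be_l2 _).
(* Column j of [G] is e_j + L y_j, the total input w_j including feedback. *)
have wE j : col j G - Bstar Bc (Q (y j)) = delta_mx j 0.
  apply/eqP; rewrite subr_eq; apply/eqP/matrixP => i l.
  rewrite [l]ord1 [LHS]mxE [LHS]mxE [X in X + _]mxE [X in _ + X]mxE.
  by rewrite [RHS]mxE [X in _ = X + _]mxE andbT.
(* With the feedback moved to the right, the closed-loop equation becomes an open-loop one driven by
   w_j, to which the cascade formulas apply. *)
have yE j k : ilam lam *: y j k - Aop A Theta Bc Cc (y j) k = Bop Bc (col j G) k.
  have := congr1 (fun f : Xs R N => f k) (RinvK _ (Be_l2 (delta_mx j 0))).
  rewrite -/(y j) /= -wE opprD addrA => /eqP; rewrite subr_eq => /eqP ->.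
  rewrite /Bop; case: (k == 0%N); last by rewrite addr0.
  by rewrite mulmxBr subrK.
have GDG : adj G *m Delta A Bc Cc theta lam *m G = 1%:M.
  apply/matrixP => i j.
  have := riccati_pairing Theta_tr Theta_unit A_hurwitz Theta_lyap ga_unit A_bdd Q_bdd
    Q_sym Lst_l2 Lst_adj riccati (y_l2 i) (y_l2 j) (yE i) (yE j).
  rewrite !wE => E.
  have -> : (adj G *m Delta A Bc Cc theta lam *m G) i j =
      (adj (col i G) *m Delta A Bc Cc theta lam *m col j G) 0 0.
    have -> : adj (col i G) = row i (adj G) by apply/matrixP => a b; rewrite !mxE.
    rewrite -row_mul [LHS]mxE [RHS]mxE; apply: eq_bigr => k _.
    by rewrite [row _ _ _ _]mxE [col _ _ _ _]mxE.
  rewrite E mxE (bigD1 i)//= big1 => [|k ki]; rewrite !mxE ?eqxx ?(negbTE ki) /=.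
    by rewrite oppr0 mul1r addr0 andbT.
  by rewrite oppr0 mul0r.
have [_ uG] := mulmx1_unit GDG.
(* A one-sided inverse of a square matrix is two-sided, so the three factors of [GDG] may be rotated
   cyclically. *)
have DGG : Delta A Bc Cc theta lam *m (G *m adj G) = 1%:M.
  by apply: mulmx1C; rewrite -mulmxA; apply: mulmx1C.
have [uD _] := mulmx1_unit DGG.
split => //; apply: (can_inj (mulKmx uD)).
by rewrite DGG mulmxV.
Qed.
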